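(* Let $f(z)$ be a function algebraic over $\mathbb{C}(z)$, solution of a differential equation $Ly(z)=0$ with $L\in\overline{\mathbb{Q}}(z)[\frac{d}{dz}]\setminus\{0\}$. Then there exist complex numbers $\lambda_1,\ldots,\lambda_p$ and functions $f_1(z),\ldots,f_p(z)$ algebraic over $\overline{\mathbb{Q}}(z)$ such that $Lf_i(z)=0$ for each $i$ and $$f(z)=\sum_{i=1}^{p}\lambda_if_i(z).$$
   Context: An embedding of $\overline{\mathbb{Q}}$ into $\mathbb{C}$ is fixed. Solutions of $Ly=0$ are considered as analytic functions on a fixed simply connected cut plane containing no singularity of $L$. *)

(* Defs.v *)
From HB Require Import structures.
From mathcomp Require Import all_boot all_order all_algebra all_field.
From mathcomp Require Import generic_quotient complex.
From mathcomp Require Import all_classical all_reals all_analysis.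

Set Implicit Arguments.
Unset Strict Implicit.
Unset Printing Implicit Defensive.

Import Order.TTheory GRing.Theory Num.Theory.
Import numFieldNormedType.Exports.

Local Open Scope classical_set_scope.
Local Open Scope ring_scope.

(* The library equips abstract numeric fields, but not [R[i]], with the
   topology of the norm. *)
Set Warnings "-redundant-canonical-projection".
HB.instance Definition _ (R : realType) := PseudoPointedMetric.copy R[i] R[i]^o.
HB.instance Definition _ (R : realType) := NormedModule.copy R[i] R[i]^o.
Set Warnings "redundant-canonical-projection".

(** Rational functions over a field [F], evaluated in a larger field [K]. *)
Section RationalFunctions.
Variable F : fieldType.
Implicit Types q : {fraction {poly F}}.

(* The representative [repr q] need not be in lowest terms. *)
Definition rat_num q : {poly F} :=
  let x := repr q in x.1 %/ gcdp x.1 x.2.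

Definition rat_den q : {poly F} :=
  let x := repr q in x.2 %/ gcdp x.1 x.2.

Lemma rat_den_neq0 q : rat_den q != 0.
Proof.
rewrite /rat_den; set x := repr q.
have d0 : x.2 != 0 := denom_ratioP x.
by rewrite dvdp_div_eq0 ?dvdp_gcdr.
Qed.

Lemma coprimep_rat q : coprimep (rat_num q) (rat_den q).
Proof.
rewrite /rat_num /rat_den; set x := repr q.
have d0 : x.2 != 0 := denom_ratioP x.
by apply: coprimep_div_gcd; rewrite d0 orbT.
Qed.

Lemma rat_numden q :
  q = FracField.tofrac (rat_num q) / FracField.tofrac (rat_den q).
Proof.
have d0 := rat_den_neq0 q; have xd0 : (repr q).2 != 0 := denom_ratioP _.
have qE : q * FracField.tofrac (repr q).2 = FracField.tofrac (repr q).1.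
  rewrite -{1}[q]reprK; move: (repr q) xd0 => x xd0.
  unlock FracField.tofrac; rewrite -[LHS]FracField.pi_mul.
  apply/eqmodP; rewrite /= FracField.equivfE /FracField.mulf.
  by rewrite !numden_Ratio ?mulr1 ?oner_eq0 // mulrC.
have g0 : gcdp (repr q).1 (repr q).2 != 0 by rewrite gcdp_eq0 negb_and xd0 orbT.
apply: (@mulIf _ (FracField.tofrac (rat_den q))); first by rewrite tofrac_eq0.
rewrite divfK ?tofrac_eq0 //.
apply: (@mulIf _ (FracField.tofrac (gcdp (repr q).1 (repr q).2))).
  by rewrite tofrac_eq0.
rewrite -mulrA -!tofracM /rat_num /rat_den.
by rewrite !divpK ?dvdp_gcdr ?dvdp_gcdl.
Qed.

Variables (K : fieldType) (iota : {rmorphism F -> K}).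

Definition rat_pole q (z : K) : Prop := root (map_poly iota (rat_den q)) z.

(* Meaningful only when [z] is not a pole of [q]. *)
Definition rat_eval q (z : K) : K :=
  (map_poly iota (rat_num q)).[z] / (map_poly iota (rat_den q)).[z].

End RationalFunctions.

(** A differential operator [\sum_i a_i (d/dz)^i] with coefficients in [F(z)] is
    encoded by the polynomial with coefficients [a_i].  Only the [F(z)]-module
    structure of [{poly _}] is relevant: its product is not the composition of
    operators. *)
Notation diffop F := {poly {fraction {poly F}}}.

Section AnalyticFunctions.
Variable R : realType.
Local Notation C := R[i].
Implicit Types (U : set C) (y : C -> C).

Definition analytic_on U y : Prop :=
  forall z0, U z0 -> exists a : nat -> C,
    \forall z \near z0, series (fun n => a n * (z - z0) ^+ n) @ \oo --> y z.

Definition simply_connected U : Prop :=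
  [/\ U !=set0,
      forall x y : C, U x -> U y -> exists g : R -> C,
        [/\ {within `[0, 1], continuous g}, g @` `[0, 1] `<=` U,
            g 0 = x & g 1 = y]
    & forall g : R -> C,
        {within `[0, 1], continuous g} -> g @` `[0, 1] `<=` U -> g 0 = g 1 ->
        exists H : R * R -> C,
          [/\ {within `[0, 1] `*` `[0, 1], continuous H},
              H @` (`[0, 1] `*` `[0, 1]) `<=` U,
              forall t, t \in `[0, 1] -> H (0, t) = g t,
              forall t, t \in `[0, 1] -> H (1, t) = g 0
            & forall s, s \in `[0, 1] -> H (s, 0) = g 0 /\ H (s, 1) = g 0]].

(** The cuts are the complement of [U]; they are only required to be closed. *)
Definition cut_plane U : Prop := open U /\ simply_connected U.

Variables (F : fieldType) (iota : {rmorphism F -> C}).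

(** An analytic function on a domain satisfies an equation with coefficients in
    [F(z)] as a meromorphic function if and only if it does so at every point
    where no coefficient has a pole. *)
Definition algebraic_on U y : Prop :=
  exists2 P : {poly {fraction {poly F}}}, P != 0 &
    forall z, U z -> (forall i, ~ rat_pole iota P`_i z) ->
      \sum_(i < size P) rat_eval iota P`_i z * y z ^+ i = 0.

Definition solution_on U (L : diffop F) y : Prop :=
  forall z, U z -> (forall i, ~ rat_pole iota L`_i z) ->
    \sum_(i < size L) rat_eval iota L`_i z * y^`(i)%classic z = 0.

(** Poles of the coefficients once the leading one is normalized to [1]. *)
Definition singularity (L : diffop F) (z : C) : Prop :=
  exists i, rat_pole iota (L`_i / lead_coef L) z.

End AnalyticFunctions.

(* Main.v *)
Require Import Defs.
From HB Require Import structures.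
From mathcomp Require Import all_boot all_order all_algebra all_field.
From mathcomp Require Import complex.
From mathcomp Require Import all_classical all_reals all_analysis.
From mathcomp Require Import ring lra zify.

Set Implicit Arguments.
Unset Strict Implicit.
Unset Printing Implicit Defensive.

Import Order.TTheory GRing.Theory Num.Theory.
Import numFieldNormedType.Exports.
Local Open Scope classical_set_scope.
Local Open Scope ring_scope.

Import ComplexField.Normc.

(** Work with the power series expansion of [f] at an algebraic point [alpha]
    of the domain, and let the derivations [D] of the field of complex numbers
    that kill the algebraic numbers act on the coefficients.  They have exactly
    the algebraic numbers as common constants ([derivation_constant]), so a
    finite-dimensional complex vector space that they stabilize is spanned by its
    vectors with algebraic coordinates ([derivation_descent]).

    The space to which this applies consists of the initial values at [alpha] of
    the solutions of [L] that are analytic on the domain and algebraic over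
    [C(z)].  To see that it is stable, take such a solution [y], with a minimal
    equation [P(z, y) = 0].  Applying [D] gives
    [P^D(z, y) + P_Y(z, y) D(y) = 0] with [P_Y(z, y)] nonzero, so that [D(y)] is
    the expansion of [- P^D(z, y) / P_Y(z, y)], which is algebraic and
    meromorphic on the whole domain.  Since [L] and [alpha] are algebraic, [D]
    commutes with [L] and [L D(y) = 0].  Finally this quotient has no pole in the
    domain: at a pole that is a regular point, the term of highest order in [L]
    would be the only one of lowest valuation ([quot_op_regular]).  Thus [D(y)]
    is again a solution of the same kind ([algebraic_solution_derivation]),
    defined on the whole domain because it is a rational function of [z] and
    [y].

    So [f] is a combination of solutions [g] of this kind with algebraic initial
    values.  All the coefficients of such a [g] are algebraic, as [D(g)] is a
    solution with zero initial values.  The equations for [g] over [C(z)] of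
    bounded degrees then form, by the same computation, a space stable under all
    [D], and the descent gives one with algebraic coefficients
    ([algebraic_elt_descent]).

    The analytic part relies on one quantitative notion, [expansion], whose
    remainder estimate is at once a form of convergence; it is stable under the
    ring operations, quotients and differentiation.  Identities between analytic
    functions pass from [alpha] to the whole domain by [identity_theorem]. *)

(** * Formal power series *)

(** The alias keeps the Cauchy product apart from the pointwise product of
    functions. *)
Definition fps (F : Type) := nat -> F.

HB.instance Definition _ (F : zmodType) := GRing.Zmodule.copy (fps F) (nat -> F).

Section FpsRing.
Variable F : comNzRingType.
Implicit Types (a b c : fps F) (p q : {poly F}).

Definition fps_mul a b : fps F := fun n => \sum_(i < n.+1) a i * b (n - i)%N.
Definition fps_of_poly p : fps F := fun n => p`_n.
Definition fps_one : fps F := fps_of_poly 1.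
Definition fps_trunc n a : {poly F} := \poly_(i < n.+1) a i.

Lemma coef_fps_trunc n a i : (i <= n)%N -> (fps_trunc n a)`_i = a i.
Proof. by move=> le_in; rewrite coef_poly ltnS le_in. Qed.

(** The coefficients up to order [n] of a product depend only on those of the
    factors, so the ring axioms and the Leibniz rule reduce to polynomials. *)
Lemma fps_mulE n a b p q i : (i <= n)%N ->
    (forall j, (j <= n)%N -> p`_j = a j) -> (forall j, (j <= n)%N -> q`_j = b j) ->
  fps_mul a b i = (p * q)`_i.
Proof.
move=> le_in pa qb; rewrite coefM; apply: eq_bigr => j _.
have := ltn_ord j; rewrite ltnS => le_ji.
by rewrite pa ?qb // ?(leq_trans _ le_in) // leq_subr.
Qed.

Lemma fps_mulA : associative fps_mul.
Proof.
move=> a b c; apply/funext => n.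
rewrite (@fps_mulE n _ _ (fps_trunc n a) (fps_trunc n b * fps_trunc n c)) //; last first.
- move=> j le_jn; symmetry.
  by apply: (fps_mulE le_jn) => i; apply: coef_fps_trunc.
- by move=> j; apply: coef_fps_trunc.
rewrite mulrA (@fps_mulE n _ _ (fps_trunc n a * fps_trunc n b) (fps_trunc n c)) //.
- move=> j le_jn; symmetry.
  by apply: (fps_mulE le_jn) => i; apply: coef_fps_trunc.
- by move=> j; apply: coef_fps_trunc.
Qed.

Lemma fps_mulC : commutative fps_mul.
Proof.
move=> a b; apply/funext => n.
rewrite (@fps_mulE n _ _ (fps_trunc n a) (fps_trunc n b)) //; last 2 first.
- by move=> j; apply: coef_fps_trunc.
- by move=> j; apply: coef_fps_trunc.
rewrite mulrC (@fps_mulE n _ _ (fps_trunc n b) (fps_trunc n a)) //.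
all: by move=> j; apply: coef_fps_trunc.
Qed.

Lemma fps_mul1 : left_id fps_one fps_mul.
Proof.
move=> a; apply/funext => n.
rewrite (@fps_mulE n _ _ 1 (fps_trunc n a)) // ?mul1r ?coef_fps_trunc //.
by move=> j; apply: coef_fps_trunc.
Qed.

Lemma fps_mulDl : left_distributive fps_mul +%R.
Proof.
move=> a b c; apply/funext => n.
rewrite -[RHS]/(\sum_(i < n.+1) a i * c (n - i)%N + \sum_(i < n.+1) b i * c (n - i)%N).
by rewrite -big_split; apply: eq_bigr => i _; apply: mulrDl.
Qed.

Lemma fps_one_neq0 : fps_one != 0.
Proof.
by apply/eqP => /(congr1 (@^~ 0%N))/eqP; rewrite /fps_one /fps_of_poly coefC /= oner_eq0.
Qed.

HB.instance Definition _ := GRing.Zmodule_isComNzRing.Build (fps F)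
  fps_mulA fps_mulC fps_mul1 fps_mulDl fps_one_neq0.

Lemma fpsD a b n : (a + b) n = a n + b n. Proof. by []. Qed.
Lemma fpsN a n : (- a) n = - a n. Proof. by []. Qed.
Lemma fps0 n : (0 : fps F) n = 0. Proof. by []. Qed.
Lemma fpsM a b n : (a * b) n = \sum_(i < n.+1) a i * b (n - i)%N. Proof. by []. Qed.
Lemma fps_sum I r (P : pred I) (f : I -> fps F) n :
  (\sum_(i <- r | P i) f i) n = \sum_(i <- r | P i) f i n.
Proof. by apply: (big_morph (fun a : fps F => a n)). Qed.

Lemma fps_of_poly_is_zmod_morphism : zmod_morphism fps_of_poly.
Proof. by move=> p q; apply/funext => n; rewrite /fps_of_poly coefB. Qed.

Lemma fps_of_poly_is_monoid_morphism : monoid_morphism fps_of_poly.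
Proof. by split=> // p q; apply/funext => n; rewrite /fps_of_poly coefM. Qed.

HB.instance Definition _ := GRing.isZmodMorphism.Build {poly F} (fps F) fps_of_poly
  fps_of_poly_is_zmod_morphism.
HB.instance Definition _ := GRing.isMonoidMorphism.Build {poly F} (fps F) fps_of_poly
  fps_of_poly_is_monoid_morphism.

Lemma fps_of_polyC0 (x : F) : fps_of_poly x%:P 0 = x.
Proof. by rewrite /fps_of_poly coefC. Qed.

Lemma fps_mulXn k a n :
  (fps_of_poly 'X^k * a) n = if (n < k)%N then 0 else a (n - k)%N.
Proof.
rewrite -[LHS]/(fps_mul _ a n) (@fps_mulE n _ _ 'X^k (fps_trunc n a)) //; last first.
  by move=> j; apply: coef_fps_trunc.
rewrite mulrC coefMXn; case: ltnP => // le_kn.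
by rewrite coef_fps_trunc ?leq_subr.
Qed.

Lemma fps_mulC0 a b : (a * b) 0%N = a 0%N * b 0%N.
Proof. by rewrite fpsM big_ord1. Qed.

Definition fps_deriv a : fps F := fun n => a n.+1 *+ n.+1.

Lemma fps_derivD a b : fps_deriv (a + b) = fps_deriv a + fps_deriv b.
Proof. by apply/funext => n; rewrite /fps_deriv fpsD mulrnDl. Qed.

Lemma fps_derivM a b :
  fps_deriv (a * b) = fps_deriv a * b + a * fps_deriv b.
Proof.
apply/funext => n; rewrite fpsD {1}/fps_deriv.
have tr c j : (j <= n)%N -> (fps_trunc n.+1 c)^`()`_j = fps_deriv c j.
  by move=> le_jn; rewrite coef_deriv coef_fps_trunc.
have tr' c j : (j <= n)%N -> (fps_trunc n.+1 c)`_j = c j.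
  by move=> le_jn; rewrite coef_fps_trunc // leqW.
rewrite -[(a * b) _]/(fps_mul a b _).
rewrite (@fps_mulE n.+1 _ _ (fps_trunc n.+1 a) (fps_trunc n.+1 b)) //; last 2 first.
- by move=> j; apply: coef_fps_trunc.
- by move=> j; apply: coef_fps_trunc.
rewrite -coef_deriv derivM coefD; congr (_ + _); symmetry.
  by apply: (@fps_mulE n) => // j; [apply: tr | apply: tr'].
by apply: (@fps_mulE n) => // j; [apply: tr' | apply: tr].
Qed.

Lemma fps_deriv_poly p : fps_deriv (fps_of_poly p) = fps_of_poly p^`().
Proof. by apply/funext => n; rewrite /fps_deriv /fps_of_poly coef_deriv. Qed.

Implicit Types (z : F).

Definition taylor z p : fps F := fps_of_poly (p \Po ('X + z%:P)).

Lemma taylor_is_zmod_morphism z : zmod_morphism (taylor z).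
Proof. by move=> p q; rewrite /taylor !rmorphB. Qed.

Lemma taylor_is_monoid_morphism z : monoid_morphism (taylor z).
Proof. by split=> [|p q]; rewrite /taylor ?rmorph1 // !rmorphM. Qed.

HB.instance Definition _ z := GRing.isZmodMorphism.Build {poly F} (fps F) (taylor z)
  (taylor_is_zmod_morphism z).
HB.instance Definition _ z := GRing.isMonoidMorphism.Build {poly F} (fps F) (taylor z)
  (taylor_is_monoid_morphism z).

Lemma coef0_taylor z p : taylor z p 0%N = p.[z].
Proof.
by rewrite /taylor /fps_of_poly -horner_coef0 horner_comp !hornerE.
Qed.

Lemma taylorC z x : taylor z x%:P = fps_of_poly x%:P.
Proof. by rewrite /taylor comp_polyC. Qed.

Lemma taylorX z : taylor z 'X = fps_of_poly ('X + z%:P).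
Proof. by rewrite /taylor comp_polyX. Qed.

End FpsRing.

Section FpsDomain.
Variable F : idomainType.
Implicit Types (a b c : fps F) (p q : {poly F}).

Lemma fps_ordP a : a != 0 ->
  exists k u, a = fps_of_poly 'X^k * u /\ u 0%N != 0.
Proof.
move=> a0.
have ex_k : exists k, a k != 0.
  apply: contrapT => /forallNP nk; move/eqP: a0; apply.
  by apply/funext => k; apply/eqP; rewrite -[_ == _]negbK; apply/negP/nk.
have [k ak mink] := ex_minnP ex_k.
exists k, (fun n => a (n + k)%N); split=> //.
apply/funext => n; rewrite fps_mulXn; case: ltnP => [lt_nk | le_kn]; last by rewrite subnK.
by apply/eqP; apply: contraTT lt_nk => /mink; rewrite leqNgt.
Qed.

Lemma fps_mulf_eq0 a b : a * b = 0 -> a = 0 \/ b = 0.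
Proof.
move=> ab0; have [-> | a0] := eqVneq a 0; first by left.
have [-> | b0] := eqVneq b 0; first by right.
have [k [u [Da u0]]] := fps_ordP a0; have [l [v [Db v0]]] := fps_ordP b0.
have : (a * b) (k + l)%N = 0 by rewrite ab0.
rewrite Da Db mulrACA -rmorphM -exprD fps_mulXn ltnn subnn fps_mulC0.
by move/eqP; rewrite mulf_eq0 (negPf u0) (negPf v0).
Qed.

Lemma fps_mulfI a b c : a != 0 -> a * b = a * c -> b = c.
Proof.
move=> a0 /eqP; rewrite -subr_eq0 -mulrBr => /eqP/fps_mulf_eq0[/eqP|/eqP].
  by rewrite (negPf a0).
by rewrite subr_eq0 => /eqP.
Qed.

Lemma taylor_inj (z : F) : injective (taylor z).
Proof.
move=> p q pq.
have : p \Po ('X + z%:P) = q \Po ('X + z%:P).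
  by apply/polyP => i; apply: (congr1 (@^~ i) pq).
move/(congr1 (comp_poly ('X - z%:P))).
by rewrite -!comp_polyA comp_polyD comp_polyX comp_polyC subrK !comp_polyXr.
Qed.

End FpsDomain.

(** * Derivations of the constants and descent *)
Section Derivations.
Variables (K : closedFieldType) (C : numFieldType) (iota : {rmorphism K -> C}).

Definition derivation_over (D : C -> C) : Prop :=
  [/\ forall x y, D (x + y) = D x + D y,
      forall x y, D (x * y) = D x * y + x * D y
    & forall k, D (iota k) = 0].

(** The graph of a derivation defined on a [K]-subalgebra.  A pair [(a, b)]
    stands for the dual number [a + b e] with [e ^ 2 = 0]: the closure conditions
    say that the graph is a subalgebra of the dual numbers. *)
Definition dgraph (G : set (C * C)) : Prop :=
  [/\ forall k, G (iota k, 0),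
      forall u v, G u -> G v -> G (u.1 + v.1, u.2 + v.2),
      forall u v, G u -> G v -> G (u.1 * v.1, u.2 * v.1 + u.1 * v.2)
    & forall y, G (0, y) -> y = 0].

(** [q] collects the derivatives of the coefficients of [p]. *)
Definition dpoly (G : set (C * C)) (p q : {poly C}) : Prop :=
  forall i, G (p`_i, q`_i).

Section Graph.
Variables (G : set (C * C)) (dG : dgraph G).

Let Gk k : G (iota k, 0). Proof. by case: dG. Qed.
Let GD u v : G u -> G v -> G (u.1 + v.1, u.2 + v.2). Proof. by case: dG => _ + _ _; apply. Qed.
Let GM u v : G u -> G v -> G (u.1 * v.1, u.2 * v.1 + u.1 * v.2).
Proof. by case: dG => _ _ + _; apply. Qed.
Let Gfun y : G (0, y) -> y = 0. Proof. by case: dG => _ _ _; apply. Qed.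
Let G0 : G (0, 0). Proof. by have := Gk 0; rewrite rmorph0. Qed.

Let GN u : G u -> G (- u.1, - u.2).
Proof.
by move/(GM (Gk (- 1))); rewrite /= rmorphN1 !mulN1r mul0r add0r.
Qed.

Let GB u v : G u -> G v -> G (u.1 - v.1, u.2 - v.2).
Proof. by move=> Gu /GN Gv; apply: (GD Gu Gv). Qed.

Let GMn u n : G u -> G (u.1 *+ n, u.2 *+ n).
Proof.
move/(GM (Gk n%:R)); rewrite /= rmorph_nat mul0r add0r => Gu.
by rewrite -mulr_natl -[u.2 *+ n]mulr_natl.
Qed.

Lemma dpolyD p q p' q' : dpoly G p q -> dpoly G p' q' -> dpoly G (p + p') (q + q').
Proof. by move=> Gp Gp' i; rewrite !coefD; apply: (GD (Gp i) (Gp' i)). Qed.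

Lemma dpolyB p q p' q' : dpoly G p q -> dpoly G p' q' -> dpoly G (p - p') (q - q').
Proof. by move=> Gp Gp' i; rewrite !coefB; apply: (GB (Gp i) (Gp' i)). Qed.

Lemma dpolyM p q p' q' :
  dpoly G p q -> dpoly G p' q' -> dpoly G (p * p') (q * p' + p * q').
Proof.
move=> Gp Gp' i; rewrite coefD !coefM -big_split /=.
elim/big_ind2: _ => [|x y z t Gx Gz|j _]; first exact: G0.
  exact: (GD Gx Gz).
exact: (GM (Gp j) (Gp' (i - j)%N)).
Qed.

Lemma dpolyC x y : G (x, y) -> dpoly G x%:P y%:P.
Proof. by move=> Gxy i; rewrite !coefC; case: eqP. Qed.

Lemma dpolyXn n : dpoly G 'X^n 0.
Proof.
move=> i; rewrite coefXn coef0; case: (i == _) => //.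
by have := Gk 1; rewrite rmorph1.
Qed.

Lemma dpoly_deriv p q : dpoly G p q -> dpoly G p^`() q^`().
Proof. by move=> Gp i; rewrite !coef_deriv; apply: (GMn _ (Gp i.+1)). Qed.

Lemma dpoly0 q : dpoly G 0 q -> q = 0.
Proof.
by move=> Gq; apply/polyP => i; rewrite coef0; apply: Gfun; have := Gq i; rewrite coef0.
Qed.

(** The condition for [xi] to be a possible value of the derivation at [x]. *)
Definition dcompat x xi : Prop :=
  forall p q, dpoly G p q -> p.[x] = 0 -> q.[x] + p^`().[x] * xi = 0.

Definition dadjoin x xi : set (C * C) :=
  [set u | exists p q, dpoly G p q /\ u = (p.[x], q.[x] + p^`().[x] * xi)].

Lemma sub_dadjoin x xi : G `<=` dadjoin x xi.
Proof.
move=> [a b] Gab; exists a%:P, b%:P; split; first exact: dpolyC.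
by rewrite derivC !hornerE.
Qed.

Lemma dadjoin_gen x xi : dadjoin x xi (x, xi).
Proof.
by exists 'X, 0; split; [exact: (dpolyXn 1) | rewrite derivX !hornerE ?mul1r ?add0r].
Qed.

Lemma dgraph_adjoin x xi : dcompat x xi -> dgraph (dadjoin x xi).
Proof.
move=> Gx; split.
- by move=> k; apply/sub_dadjoin/Gk.
- move=> _ _ [p [q [Gp ->]]] [p' [q' [Gp' ->]]] /=.
  exists (p + p'), (q + q'); split; first exact: dpolyD.
  by rewrite derivD !hornerD; congr (_, _); ring.
- move=> _ _ [p [q [Gp ->]]] [p' [q' [Gp' ->]]] /=.
  exists (p * p'), (q * p' + p * q'); split; first exact: dpolyM.
  by rewrite derivM !hornerD !hornerM; congr (_, _); ring.
by move=> y [p [q [Gp [p0 ->]]]]; apply: Gx.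
Qed.

(** The second component is the quotient rule. *)
Definition dfrac : set (C * C) :=
  [set u | exists a b, [/\ G a, G b, b.1 != 0
     & u = (a.1 / b.1, (a.2 * b.1 - a.1 * b.2) / b.1 ^+ 2)]].

Lemma sub_dfrac : G `<=` dfrac.
Proof.
move=> [a b] Gab; exists (a, b), (1, 0); split=> //=.
  by have := Gk 1; rewrite rmorph1.
by rewrite expr1n !divr1 mulr1 mulr0 subr0.
Qed.

Lemma dgraph_frac : dgraph dfrac.
Proof.
split.
- by move=> k; apply/sub_dfrac/Gk.
- move=> _ _ [a [b [Ga Gb b0 ->]]] [c [d [Gc Gd d0 ->]]] /=.
  exists (a.1 * d.1 + c.1 * b.1,
          (a.2 * d.1 + a.1 * d.2) + (c.2 * b.1 + c.1 * b.2)).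
  exists (b.1 * d.1, b.2 * d.1 + b.1 * d.2); split=> /=.
  + exact: (GD (GM Ga Gd) (GM Gc Gb)).
  + exact: (GM Gb Gd).
  + by rewrite mulf_neq0.
  by congr (_, _); field; rewrite b0 d0.
- move=> _ _ [a [b [Ga Gb b0 ->]]] [c [d [Gc Gd d0 ->]]] /=.
  exists (a.1 * c.1, a.2 * c.1 + a.1 * c.2).
  exists (b.1 * d.1, b.2 * d.1 + b.1 * d.2); split=> /=.
  + exact: (GM Ga Gc).
  + exact: (GM Gb Gd).
  + by rewrite mulf_neq0.
  by congr (_, _); field; rewrite b0 d0.
move=> y [[a a'] [b [Ga Gb b0 [/esym/eqP]]]] /=.
rewrite mulf_eq0 invr_eq0 (negPf b0) orbF => /eqP a0 ->.
by move: Ga; rewrite a0 => /Gfun ->; rewrite !mul0r subr0 mul0r.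
Qed.

Lemma dfrac_inv u : G u -> u.1 != 0 -> dfrac (u.1^-1, - u.2 / u.1 ^+ 2).
Proof.
move=> Gu u0; exists (1, 0), u; split=> //=; last by rewrite !mul1r mul0r sub0r.
by have := Gk 1; rewrite rmorph1.
Qed.

(** If [x] is transcendental over the domain of [G], every [xi] is possible; if
    it is algebraic, the minimal equation forces the value, and elimination of
    leading terms shows that this value is compatible with every equation. *)
Lemma dcompat_exists x :
    (forall u, G u -> u.1 != 0 -> G (u.1^-1, - u.2 / u.1 ^+ 2)) ->
  exists xi, dcompat x xi.
Proof.
move=> GV.
have [[m0 [r0 [Gm0 m0_neq0 m0x]]]|no_eq] := pselect (exists p q,
  [/\ dpoly G p q, p != 0 & p.[x] = 0]); last first.
  exists 0 => p q Gp px0.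
  have p0 : p = 0.
    by apply/eqP; rewrite -[_ == _]negbK; apply/negP => p0; apply: no_eq; exists p, q.
  by move: Gp; rewrite p0 => /dpoly0 ->; rewrite deriv0 !horner0 mul0r addr0.
pose hasz n := `[< exists p q, [/\ dpoly G p q, p != 0, p.[x] = 0 & size p = n] >].
have ex_n : exists n, hasz n by exists (size m0); apply/asboolP; exists m0, r0.
have [n /asboolP[m [r [Gm m_neq0 mx0 size_m]]] min_m] := ex_minnP ex_n.
have minm p q : dpoly G p q -> p.[x] = 0 -> (size p < size m)%N -> p = 0.
  move=> Gp px0; rewrite size_m ltnNge => /negP lt_pm; apply/eqP.
  rewrite -[_ == _]negbK; apply/negP => p0; apply: lt_pm.
  by apply: min_m; apply/asboolP; exists p, q.
have dm_neq0 : m^`().[x] != 0.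
  apply/eqP => dmx0.
  have dm0 : m^`() = 0 by apply: (minm _ _ (dpoly_deriv Gm)) => //; apply: lt_size_deriv.
  have m_le1 : (size m <= 1)%N.
    apply/leq_sizeP => -[//|i] _; apply/eqP.
    have /eqP := congr1 (fun p : {poly C} => p`_i) dm0.
    by rewrite coef_deriv coef0 mulrn_eq0.
  move: mx0 m_neq0; rewrite (size1_polyC m_le1) hornerC => ->.
  by rewrite eqxx.
(* Differentiate the minimal equation [m] at [x]. *)
exists (- r.[x] / m^`().[x]) => p q.
elim: {p}(size p).+1 {-2}p (ltnSn (size p)) q => // k IHk p lt_pk q Gp px0.
have [p0 | p_neq0] := eqVneq p 0.
  by move: Gp; rewrite p0 => /dpoly0 ->; rewrite deriv0 !horner0 mul0r addr0.
have le_mp : (size m <= size p)%N.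
  by rewrite leqNgt; apply: contraNN p_neq0 => lt_pm; rewrite (minm _ _ Gp).
pose j := (size p - size m)%N.
have [d Gc] : exists d, G (lead_coef p / lead_coef m, d).
  have lm0 : lead_coef m != 0 by rewrite lead_coef_eq0.
  eexists; apply: (GM (Gp _) (GV _ (Gm _) lm0)).
set c := _ / _ in Gc.
have Gs := dpolyM (dpolyM (dpolyC Gc) (dpolyXn j)) Gm.
pose s : {poly C} := c%:P * 'X^j * m.
pose t : {poly C} := (d%:P * 'X^j + c%:P * 0) * m + c%:P * 'X^j * r.
rewrite -/s -/t in Gs.
have size_s : size s = size p.
  have c0 : c != 0 by rewrite mulf_neq0 ?invr_eq0 ?lead_coef_eq0.
  rewrite /s -mulrA mul_polyC size_scale // mulrC size_mulXn // /j.
  by rewrite subnK.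
have lead_s : lead_coef s = lead_coef p.
  rewrite /s !lead_coefM lead_coefC lead_coefXn mulr1 divfK //.
  by rewrite lead_coef_eq0.
have lt_ps : (size (p - s)%R < k)%N.
  have /leq_ltn_trans : (size (p - s)%R <= (size p).-1)%N.
    apply/leq_sizeP => i; rewrite leq_eqVlt coefB => /orP[/eqP <-|].
      by rewrite -[p`_ _]/(lead_coef p) -size_s -lead_s subrr.
    rewrite prednK ?size_poly_gt0 // => le_pi.
    by rewrite !nth_default ?subr0 ?size_s.
  by apply; rewrite prednK ?size_poly_gt0.
have sx0 : s.[x] = 0 by rewrite /s !hornerE mx0 mulr0.
have := IHk _ lt_ps _ (dpolyB Gp Gs).
rewrite !derivB !hornerD !hornerN px0 sx0 subr0 => /(_ erefl) <-.
rewrite /s /t !derivM derivC derivXn !hornerE mx0 /=.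
by field.
Qed.

End Graph.

(** Zorn's lemma; the empty set is admitted only to bound the empty chain. *)
Lemma dgraph_maximal G0 : dgraph G0 ->
  exists G, [/\ dgraph G, G0 `<=` G & forall H, dgraph H -> G `<=` H -> H `<=` G].
Proof.
move=> dG0; have [dG0k _ _ _] := dG0.
pose P (A : set (C * C)) := A = set0 \/ (dgraph A /\ G0 `<=` A).
have [|A [PA maxA]] := @Zorn_bigcup _ P.
  move=> S SP totS.
  have [[X0 [SX0 [X0d subX0]]]|noX] := pselect (exists X, S X /\ dgraph X /\ G0 `<=` X); last first.
    left; apply/seteqP; split=> // u [X SX Xu].
    case: (SP X SX) => [X_0|dX]; first by rewrite X_0 in Xu.
    by case: noX; exists X.
  have common u v : (\bigcup_(X in S) X) u -> (\bigcup_(X in S) X) v ->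
      exists X, [/\ S X, dgraph X, X u & X v].
    move=> [X SX Xu] [Y SY Yv].
    have dX Z w : S Z -> Z w -> dgraph Z.
      by move=> SZ Zw; case: (SP Z SZ) => [Z0|[]//]; rewrite Z0 in Zw.
    have [XY|YX] := totS X Y SX SY.
      by exists Y; split=> //; [apply: dX Yv | apply: XY].
    by exists X; split=> //; [apply: dX Xu | apply: YX].
  right; split; last by move=> u G0u; exists X0 => //; apply: subX0.
  split.
  - by move=> k; exists X0 => //; apply/subX0/dG0k.
  - move=> u v Su Sv; have [X [SX [_ XD _ _] Xu Xv]] := common u v Su Sv.
    by exists X => //; apply: XD.
  - move=> u v Su Sv; have [X [SX [_ _ XM _] Xu Xv]] := common u v Su Sv.
    by exists X => //; apply: XM.
  by move=> y [X SX Xy]; have [] := common (0, y) (0, y); [exists X | exists X |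
    move=> Y [_ [_ _ _ Yfun] /Yfun]].
have [A0|[dA subA]] := PA.
  case: (maxA G0); last by right; split.
  by rewrite A0; split=> // /(_ _ (dG0k 0)).
exists A; split=> // H dH AH; apply: contrapT => nHA.
by apply: (maxA H); [split | right; split=> //; apply: subset_trans AH].
Qed.

(** A maximal graph contains its fractions and, its domain being a field, every
    [x]. *)
Lemma dgraph_total G : dgraph G ->
  exists D, derivation_over D /\ forall x y, G (x, y) -> D x = y.
Proof.
move=> /dgraph_maximal[A [dA subA maxA]].
have AV u : A u -> u.1 != 0 -> A (u.1^-1, - u.2 / u.1 ^+ 2).
  move=> Au u0; apply: (maxA _ (dgraph_frac dA)); first exact: sub_dfrac.
  exact: dfrac_inv.
have Atotal x : exists y, A (x, y).
  have [xi Ax] := dcompat_exists dA x AV; exists xi.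
  apply: (maxA _ (dgraph_adjoin dA Ax)); first exact: sub_dadjoin.
  exact: dadjoin_gen.
have [D AD] := choice Atotal.
have [Ak Aadd Amul Afun] := dA.
have A_eq x y : A (x, y) -> D x = y.
  move=> Axy; apply/eqP; rewrite -subr_eq0; apply/eqP/Afun.
  have := Aadd _ _ (AD x) (Amul _ _ (Ak (- 1)) Axy).
  by rewrite /= rmorphN1 !mulN1r mul0r add0r subrr.
exists D; split=> [|x y /subA]; last exact: A_eq.
split=> [x y|x y|k]; apply: A_eq => //.
- exact: (Aadd _ _ (AD x) (AD y)).
- exact: (Amul _ _ (AD x) (AD y)).
Qed.

(** As [K] is algebraically closed, an [x] outside of [K] is transcendental, and
    there is a derivation with value [1] at [x]. *)
Lemma derivation_constant x :
  (forall D, derivation_over D -> D x = 0) -> exists k, x = iota k.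
Proof.
move=> Dx0; apply: contrapT => /forallNP nK.
pose G0 : set (C * C) := [set u | exists k, u = (iota k, 0)].
have dG0 : dgraph G0.
  split.
  - by move=> k; exists k.
  - by move=> _ _ [k ->] [l ->]; exists (k + l); rewrite rmorphD addr0.
  - by move=> _ _ [k ->] [l ->]; exists (k * l); rewrite rmorphM mul0r mulr0 addr0.
  - by move=> y [k [_ ->]].
have transx (p : {poly C}) : (forall i, exists k, p`_i = iota k) -> p.[x] = 0 -> p = 0.
  move=> pK px0; have [q qp] := choice pK.
  pose r := \poly_(i < size p) q i.
  have rp : map_poly iota r = p.
    apply/polyP => i; rewrite coef_map coef_poly; case: ltnP => [_|le_pi]; first by rewrite qp.
    by rewrite /= rmorph0 nth_default.
  apply/eqP; rewrite -rp map_poly_eq0; apply/negPn/negP => r0.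
  have [s rE] := closed_field_poly_normal r.
  have : root (map_poly iota r) x by rewrite rp; apply/eqP.
  rewrite rE map_polyZ rmorph_prod rootZ ?fmorph_eq0 ?lead_coef_eq0 //.
  rewrite (eq_bigr (fun z => 'X - (iota z)%:P)) => [|z _]; last first.
    by rewrite rmorphB /= map_polyX map_polyC.
  rewrite -(big_map iota predT (fun z => 'X - z%:P)) root_prod_XsubC.
  by case/mapP => k _ /nK.
have cx : dcompat G0 x 1.
  move=> p q Gp px0.
  have p0 : p = 0 by apply: transx => // i; have [k [-> _]] := Gp i; exists k.
  have -> : q = 0 by apply/polyP => i; have [k [_ ->]] := Gp i; rewrite coef0.
  by rewrite p0 deriv0 !horner0 mul0r addr0.
have [D [derD GD]] := dgraph_total (dgraph_adjoin dG0 cx).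
have := GD _ _ (dadjoin_gen dG0 x 1); rewrite Dx0 // => /esym/eqP.
by rewrite oner_eq0.
Qed.

Section DerivationTheory.
Variables (D : C -> C) (derD : derivation_over D).

Lemma derivationD x y : D (x + y) = D x + D y. Proof. by case: derD. Qed.
Lemma derivationM x y : D (x * y) = D x * y + x * D y. Proof. by case: derD. Qed.
Lemma derivationK k : D (iota k) = 0. Proof. by case: derD. Qed.
Lemma derivation0 : D 0 = 0. Proof. by have := derivationK 0; rewrite rmorph0. Qed.
Lemma derivation_nat n : D (n%:R) = 0.
Proof. by rewrite -(rmorph_nat iota) derivationK. Qed.
Lemma derivation1 : D 1 = 0. Proof. exact: (derivation_nat 1). Qed.
Lemma derivationMn x n : D (x *+ n) = D x *+ n.
Proof. by rewrite -mulr_natl derivationM derivation_nat mul0r add0r mulr_natl. Qed.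
Lemma derivation_sum I r (P : pred I) (f : I -> C) :
  D (\sum_(i <- r | P i) f i) = \sum_(i <- r | P i) D (f i).
Proof. exact: (big_morph D derivationD derivation0). Qed.

End DerivationTheory.

(** A nonzero vector of minimal support in [W], with a coordinate equal to [1],
    has constant coordinates, since its derivatives lie in [W] and have smaller
    support.  Subtracting a multiple of it from [w] shrinks the support of [w]. *)
Lemma derivation_descent (I : finType) (W : set (I -> C)) :
    (forall u v, W u -> W v -> W (fun i => u i + v i)) ->
    (forall c u, W u -> W (fun i => c * u i)) ->
    (forall D u, derivation_over D -> W u -> W (fun i => D (u i))) ->
  forall w, W w -> exists (p : nat) (lambda : 'I_p -> C) (v : 'I_p -> I -> K),
    (forall j, W (fun i => iota (v j i))) /\
    (forall i, w i = \sum_(j < p) lambda j * iota (v j i)).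
Proof.
move=> WD WZ Wder w; pose supp (u : I -> C) : {set I} := finset (fun i => u i != 0).
elim: {w}#|supp w|.+1 {-2}w (ltnSn #|supp w|) => // n IHn w lt_wn Ww.
have [w0 | w_neq0] := eqVneq (supp w) finset.set0.
  exists 0%N, (fun _ => 0), (fun _ _ => 0); split=> [[]//|i].
  rewrite big_ord0; apply/eqP; rewrite -[_ == _]negbK.
  by apply/negP => wi; have := finset.in_set0 i; rewrite -w0 inE wi.
pose hasz m := `[< exists u, [/\ W u, supp u \subset supp w, supp u != finset.set0
   & #|supp u| = m] >].
have ex_m : exists m, hasz m by exists #|supp w|; apply/asboolP; exists w.
have [m /asboolP[u [Wu sub_uw u_neq0 size_u]] min_m] := ex_minnP ex_m.
have [j uj] := set0Pn _ u_neq0; rewrite inE in uj.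
pose u1 i := (u j)^-1 * u i.
have Wu1 : W u1 by apply: WZ.
have supp_u1 : supp u1 = supp u.
  by apply/setP => i; rewrite !inE mulf_eq0 invr_eq0 (negPf uj).
have u1j : u1 j = 1 by rewrite /u1 mulVf.
have /choice[v vE] : forall i, exists k, u1 i = iota k.
  move=> i; apply: derivation_constant => D derD.
  apply/eqP/negPn/negP => Dui.
  pose t i := D (u1 i); have Wt : W t by apply: Wder.
  have sub_tu : supp t \proper supp u.
    apply/properP; split.
      apply/fintype.subsetP => l; rewrite -supp_u1 !inE; apply: contraNN => /eqP ul.
      by rewrite /t ul derivation0.
    by exists j; rewrite inE // negbK /t u1j (derivation1 derD).
  have /min_m : hasz #|supp t|.
    apply/asboolP; exists t; split=> //.
      by apply: fintype.subset_trans sub_uw; apply: proper_sub.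
    by apply/set0Pn; exists i; rewrite inE.
  by rewrite -size_u leqNgt proper_card.
pose w1 i := w i + - w j * u1 i.
have wj : w j != 0 by have /fintype.subsetP/(_ j) := sub_uw; rewrite !inE; apply.
have lt_w1 : (#|supp w1| < n)%N.
  rewrite -ltnS; apply: leq_trans lt_wn; rewrite ltnS; apply: proper_card.
  apply/properP; split.
    apply/fintype.subsetP => l; rewrite !inE; apply: contraNN => /eqP wl.
    have : l \notin supp u by apply: contraTN isT => /(fintype.subsetP sub_uw); rewrite inE wl eqxx.
    by rewrite -supp_u1 inE negbK /w1 wl => /eqP ->; rewrite mulr0 addr0.
  by exists j; rewrite inE // negbK /w1 u1j mulr1 subrr.
have [p [lambda [v' [Wv' w1E]]]] := IHn w1 lt_w1 (WD _ _ Ww (WZ _ _ Wu1)).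
exists p.+1, (fun l => if unlift ord0 l is Some l' then lambda l' else w j).
exists (fun l => if unlift ord0 l is Some l' then v' l' else v); split=> [l|i].
  case: unliftP => [l' _|_]; first exact: Wv'.
  by rewrite (_ : (fun i => _) = u1) //; apply/funext => i; rewrite vE.
rewrite big_ord_recl unlift_none -vE.
under eq_bigr => l _ do rewrite liftK.
by rewrite -w1E /w1 addrCA mulNr subrr addr0.
Qed.

End Derivations.

(** * Algebraic elements over a domain *)

(** Multiplying by a leading coefficient reduces the stability under sums and
    products to that of integral elements. *)
Section AlgebraicElements.
Variables (R : idomainType) (S : comNzRingType) (phi : {rmorphism R -> S}).
Hypotheses (phi_inj : injective phi)
  (S_domain : forall a b : S, a * b = 0 -> a = 0 \/ b = 0).
Implicit Types (u v w : S).

Definition algebraic_elt u := exists2 P : {poly R}, P != 0 & (map_poly phi P).[u] = 0.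

Lemma algebraic_eltP u :
  algebraic_elt u <-> exists2 c, c != 0 & integralOver phi (phi c * u).
Proof.
split=> [[P P0 Pu]|[c c0 [q q_mon qcu]]]; last first.
  exists (q \Po (c *: 'X)).
    by rewrite comp_poly2_eq0 ?monic_neq0 // size_scale ?size_polyX.
  rewrite map_comp_poly horner_comp map_polyZ map_polyX hornerZ hornerX.
  exact/eqP.
pose d := (size P).-1; exists (lead_coef P); first by rewrite lead_coef_eq0.
have size_P : size P = d.+1 by rewrite prednK // size_poly_gt0.
have PuE : \sum_(i < d) phi P`_i * u ^+ i + phi (lead_coef P) * u ^+ d = 0.
  rewrite -[RHS]Pu (@horner_coef_wide _ d.+1); last by rewrite -size_P size_poly.
  rewrite big_ord_recr /= coef_map; congr (_ + _).
  by apply: eq_bigr => i _; rewrite coef_map.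
have d_gt0 : (0 < d)%N.
  rewrite lt0n; apply: contraNneq P0 => d0; move: PuE; rewrite d0 big_ord0 add0r mulr1.
  by rewrite -(rmorph0 phi) => /phi_inj/eqP; rewrite lead_coef_eq0.
have lt_q : (size (\poly_(i < d) (P`_i * lead_coef P ^+ (d.-1 - i)))%R < size ('X^d : {poly R}))%N.
  by rewrite size_polyXn ltnS size_poly.
exists ('X^d + \poly_(i < d) (P`_i * lead_coef P ^+ (d.-1 - i))).
  by rewrite monicE lead_coefDl // lead_coefXn.
rewrite rootE rmorphD /= map_polyXn hornerD hornerXn.
rewrite (@horner_coef_wide _ d); last first.
  by apply: leq_trans (size_poly _ _) _; rewrite size_poly.
rewrite (eq_bigr (fun i : 'I_d => phi (lead_coef P) ^+ d.-1 * (phi P`_i * u ^+ i))) => [|i _].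
  rewrite -mulr_sumr exprMn -{1}(prednK d_gt0) exprSr -mulrA -mulrDr addrC.
  by rewrite PuE mulr0.
rewrite coef_map coef_poly ltn_ord /= rmorphM rmorphXn /= exprMn.
have -> : phi (lead_coef P) ^+ d.-1 = phi (lead_coef P) ^+ (d.-1 - i) * phi (lead_coef P) ^+ i.
  by rewrite -exprD subnK // -ltnS prednK.
by ring.
Qed.

Lemma algebraic_elt_img c : algebraic_elt (phi c).
Proof. by apply/algebraic_eltP; exists 1; rewrite ?oner_neq0 // -rmorphM; apply: integral_id. Qed.

Lemma algebraic_eltD u v : algebraic_elt u -> algebraic_elt v -> algebraic_elt (u + v).
Proof.
move=> /algebraic_eltP[c c0 cu] /algebraic_eltP[d d0 dv]; apply/algebraic_eltP.
exists (c * d); first by rewrite mulf_neq0.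
have -> : phi (c * d) * (u + v) = phi d * (phi c * u) + phi c * (phi d * v).
  by rewrite rmorphM; ring.
by apply: integral_add; apply: integral_mul => //; apply: integral_id.
Qed.

Lemma algebraic_eltM u v : algebraic_elt u -> algebraic_elt v -> algebraic_elt (u * v).
Proof.
move=> /algebraic_eltP[c c0 cu] /algebraic_eltP[d d0 dv]; apply/algebraic_eltP.
exists (c * d); first by rewrite mulf_neq0.
have -> : phi (c * d) * (u * v) = (phi c * u) * (phi d * v) by rewrite rmorphM; ring.
exact: integral_mul.
Qed.

Lemma algebraic_elt_horner (P : {poly R}) u : algebraic_elt u -> algebraic_elt (map_poly phi P).[u].
Proof.
move=> alg_u; elim/poly_ind: P => [|P c IHP].
  by rewrite rmorph0 horner0 -(rmorph0 phi); apply: algebraic_elt_img.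
rewrite rmorphD rmorphM /= map_polyX map_polyC hornerMXaddC.
by apply: algebraic_eltD (algebraic_elt_img _); apply: algebraic_eltM.
Qed.

(** An equation for [u] with nonzero constant term [c] makes [c / u] a
    polynomial in [u]. *)
Lemma algebraic_elt_quotient u v w :
  u != 0 -> algebraic_elt u -> algebraic_elt v -> u * w = v -> algebraic_elt w.
Proof.
move=> u0 alg_u alg_v uw.
have [Q [c [c0 Qu]]] : exists Q c, c != 0 /\ (map_poly phi Q).[u] * u = phi c.
  have [P] := alg_u; elim/poly_ind: P => [|P c IHP]; first by rewrite eqxx.
  have [->|c0 _] := eqVneq c 0.
    rewrite polyC0 addr0 rmorphM /= map_polyX hornerMX => PX0 /S_domain[Pu|/eqP]; last by rewrite (negPf u0).
    by apply: IHP => //; apply: contraNneq PX0 => ->; rewrite mul0r.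
  rewrite rmorphD rmorphM /= map_polyX map_polyC hornerMXaddC => Pu.
  exists (- P), c; split=> //; rewrite rmorphN hornerN mulNr.
  by apply/eqP; rewrite eq_sym -addr_eq0 addrC Pu.
have : algebraic_elt (phi c * w).
  by rewrite -Qu -mulrA uw; apply: algebraic_eltM => //; apply: algebraic_elt_horner.
case/algebraic_eltP => d d0 dcw; apply/algebraic_eltP.
by exists (d * c); rewrite ?mulf_neq0 // rmorphM -mulrA.
Qed.

End AlgebraicElements.

(** * Derivations of the constants acting on power series *)
Section CoefDerivation.
Variables (K : closedFieldType) (C : numFieldType) (iota : {rmorphism K -> C}).
Variables (D : C -> C) (derD : derivation_over iota D).
Implicit Types (a b : fps C).

Definition fps_map (a : fps C) : fps C := fun n => D (a n).

Lemma fps_mapD a b : fps_map (a + b) = fps_map a + fps_map b.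
Proof. by apply/funext => n; apply: (derivationD derD). Qed.

Lemma fps_mapM a b : fps_map (a * b) = fps_map a * b + a * fps_map b.
Proof.
apply/funext => n; rewrite -[LHS]/(D (\sum_(i < n.+1) a i * b (n - i)%N)) (derivation_sum derD).
rewrite -[RHS]/(\sum_(i < n.+1) D (a i) * b (n - i)%N
  + \sum_(i < n.+1) a i * D (b (n - i)%N)).
by rewrite -big_split; apply: eq_bigr => i _; apply: (derivationM derD).
Qed.

Lemma fps_map0 : fps_map 0 = 0.
Proof. by apply/funext => n; apply: (derivation0 derD). Qed.

Lemma fps_map_sum I r (P : pred I) (f : I -> fps C) :
  fps_map (\sum_(i <- r | P i) f i) = \sum_(i <- r | P i) fps_map (f i).
Proof. exact: (big_morph fps_map fps_mapD fps_map0). Qed.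

Lemma fps_map_deriv a : fps_map (fps_deriv a) = fps_deriv (fps_map a).
Proof. by apply/funext => n; apply: (derivationMn derD). Qed.

Lemma fps_map_derivn i a : fps_map (iter i (@fps_deriv C) a) = iter i (@fps_deriv C) (fps_map a).
Proof. by elim: i => //= i IHi; rewrite fps_map_deriv IHi. Qed.

Lemma fps_map_eq0 a : (forall n, exists k, a n = iota k) -> fps_map a = 0.
Proof.
by move=> aK; apply/funext => n; rewrite /fps_map; have [k ->] := aK n; apply: (derivationK derD).
Qed.

Variable alpha : K.
Local Notation taylor_alpha := (taylor (iota alpha)).

Lemma taylor_iota (p : {poly K}) n : exists k, taylor_alpha (map_poly iota p) n = iota k.
Proof.
exists (p \Po ('X + alpha%:P))`_n.
rewrite /taylor /fps_of_poly -coef_map map_comp_poly rmorphD /=.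
by rewrite map_polyX map_polyC.
Qed.

Lemma map_derivationMXaddC (p : {poly C}) x :
  map_poly D (p * 'X + x%:P) = map_poly D p * 'X + (D x)%:P.
Proof.
apply/polyP => i; rewrite coef_map_id0 ?(derivation0 derD) // !coefD !coefMX !coefC.
rewrite (derivationD derD); case: i => [|i] /=; first by rewrite (derivation0 derD).
by rewrite coef_map_id0 ?(derivation0 derD).
Qed.

Lemma map_derivation0 : map_poly D 0 = 0.
Proof. by apply/polyP => i; rewrite coef_map_id0 ?coef0 ?(derivation0 derD). Qed.

Lemma fps_map_taylor (p : {poly C}) : fps_map (taylor_alpha p) = taylor_alpha (map_poly D p).
Proof.
elim/poly_ind: p => [|p x IHp].
  by rewrite map_derivation0 !rmorph0 fps_map0.
rewrite map_derivationMXaddC !rmorphD !rmorphM /= fps_mapD fps_mapM IHp.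
rewrite [X in _ + X + _](_ : _ = 0) ?addr0.
  congr (_ + _); rewrite !taylorC; apply/funext => n; rewrite /fps_map /fps_of_poly !coefC.
  by case: eqP => // _; rewrite (derivation0 derD).
rewrite (_ : fps_map _ = 0) ?mulr0 // -(map_polyX iota).
exact/fps_map_eq0/taylor_iota.
Qed.

(** The rule [D(P(z, y)) = P^D(z, y) + P_Y(z, y) D(y)], valid because the
    centre [iota alpha] is a constant. *)
Lemma fps_map_horner (P : {poly {poly C}}) a :
  fps_map (map_poly taylor_alpha P).[a] =
    (map_poly taylor_alpha (map_poly (map_poly D) P)).[a]
    + (map_poly taylor_alpha P^`()).[a] * fps_map a.
Proof.
elim/poly_ind: P => [|P p IHP].
  rewrite deriv0 (_ : map_poly (map_poly D) 0 = 0) ?rmorph0 ?horner0 ?mul0r ?addr0 ?fps_map0 //.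
  by apply/polyP => i; rewrite coef_map_id0 ?coef0 ?map_derivation0.
have -> : map_poly (map_poly D) (P * 'X + p%:P) =
    map_poly (map_poly D) P * 'X + (map_poly D p)%:P.
  apply/polyP => i; rewrite coef_map_id0 ?map_derivation0 // !coefD !coefMX !coefC.
  case: i => [|i] /=; first by rewrite !add0r.
  by rewrite !addr0 coef_map_id0 ?map_derivation0.
rewrite derivD derivM derivX derivC addr0 mulr1.
rewrite !rmorphD !rmorphM /= !map_polyX !map_polyC !hornerMXaddC !hornerD hornerMX.
rewrite fps_mapD fps_mapM IHP fps_map_taylor; ring.
Qed.

End CoefDerivation.

(** * Linear differential equations in power series *)
Section FormalOperator.
Variable F : numFieldType.
Local Notation deriv := (@fps_deriv F).
Implicit Types (a m n w : fps F) (l : nat -> fps F).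

Definition fps_op l r a : fps F := \sum_(i < r.+1) l i * iter i deriv a.

Lemma fps_derivnE i a j : iter i deriv a j = a (j + i)%N *+ (j + i) ^_ i.
Proof.
elim: i j => [|i IHi] j; first by rewrite addn0 ffactn0 mulr1n.
rewrite iterS /fps_deriv IHi addSnnS -mulrnA; congr (_ *+ _).
by rewrite ffactnSr addnS -addSn addnK.
Qed.

(** The leading coefficient does not vanish at the centre, so the coefficient of
    order [k - r] of the equation isolates the lowest coefficient [a k]. *)
Lemma fps_op_inj l r a :
  l r 0%N != 0 -> fps_op l r a = 0 -> (forall i, (i < r)%N -> a i = 0) -> a = 0.
Proof.
move=> lr0 La0 a_init; apply/eqP/negPn/negP => /fps_ordP[k [u [Da u0]]].
have ak : a k != 0 by rewrite Da fps_mulXn ltnn subnn.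
have le_rk : (r <= k)%N by rewrite leqNgt; apply: contraNN ak => /a_init ->.
have a_lt j : (j < k)%N -> a j = 0 by move=> lt_jk; rewrite Da fps_mulXn lt_jk.
have : fps_op l r a (k - r)%N = 0 by rewrite La0.
rewrite /fps_op fps_sum big_ord_recr /= big1 ?add0r => [|i _]; last first.
  rewrite fpsM big1 // => j _; rewrite fps_derivnE a_lt ?mul0rn ?mulr0 //.
  by have := ltn_ord i; lia.
rewrite fpsM big_ord_recl big1 ?addr0 => [|j _]; last first.
  rewrite fps_derivnE a_lt ?mul0rn ?mulr0 //= /bump /=.
  by have := ltn_ord j; lia.
rewrite /= subn0 fps_derivnE subnK // => /eqP; rewrite mulf_eq0 (negPf lr0) mulrn_eq0.
by rewrite (negPf ak) orbF eqn0Ngt ffact_gt0 le_rk.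
Qed.

(** [quot_num n m i / m ^ i.+1] is the [i]-th derivative of [n / m], and
    [quot_op l r n m / m ^ r.+1] is the value of the operator at [n / m]: these
    numerators are power series even when [n / m] has a pole. *)
Fixpoint quot_num n m i : fps F :=
  if i is j.+1 then deriv (quot_num n m j) * m - j.+1%:R * quot_num n m j * deriv m
  else n.

Definition quot_op l r n m : fps F :=
  \sum_(i < r.+1) l i * quot_num n m i * m ^+ (r - i).

Lemma fps_derivXn m i : deriv (m ^+ i.+1) = i.+1%:R * m ^+ i * deriv m.
Proof.
elim: i => [|i IHi]; first by rewrite expr1 expr0 !mul1r.
rewrite exprS fps_derivM IHi [i.+2%:R]mulrS exprS; ring.
Qed.

Lemma quot_numE n m w i : m * w = n -> quot_num n m i = m ^+ i.+1 * iter i deriv w.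
Proof.
move=> mw; elim: i => [|i IHi] /=; first by rewrite expr1.
rewrite IHi fps_derivM fps_derivXn !exprS; ring.
Qed.

Lemma quot_opE l r n m w : m * w = n -> quot_op l r n m = m ^+ r.+1 * fps_op l r w.
Proof.
move=> mw; rewrite /quot_op /fps_op mulr_sumr; apply: eq_bigr => i _.
have -> : m ^+ r.+1 = m ^+ i.+1 * m ^+ (r - i).
  by rewrite -exprD addSn subnKC // -ltnS.
rewrite (quot_numE _ mw); ring.
Qed.

Local Notation X k := (fps_of_poly 'X^k : fps F).

Lemma deriv_mulXn k a : X 1 * deriv (X k * a) = X k * (k%:R * a + X 1 * deriv a).
Proof.
rewrite fps_derivM fps_deriv_poly derivXn.
have -> : X 1 * (fps_of_poly ('X^(k.-1) *+ k) * a + X k * deriv a) =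
  (X 1 * fps_of_poly ('X^(k.-1) *+ k)) * a + X k * (X 1 * deriv a) by ring.
have -> : X 1 * fps_of_poly ('X^(k.-1) *+ k) = X k * k%:R.
  rewrite rmorphMn mulr_natr mulrnAr; case: k => [|k]; first by rewrite !mulr0n.
  by rewrite -rmorphM -exprD add1n.
ring.
Qed.

Lemma fps_nat0 k : (k%:R : fps F) 0%N = k%:R.
Proof. rewrite -[k%:R in LHS](rmorph_nat (@fps_of_poly F)) -polyC_natr; exact: fps_of_polyC0. Qed.

(** The [i]-th derivative of a series with a pole of order [k - j] has a pole of
    order [k - j + i]. *)
Lemma quot_num_order (k j : nat) m n i : (j < k)%N -> m 0%N != 0 -> n 0%N != 0 ->
  exists u, quot_num (X j * n) (X k * m) i = X (j + i * k.-1) * u /\ u 0%N != 0.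
Proof.
move=> lt_jk m0 n0; elim: i => [|i [u [Du u0]]]; first by exists n; rewrite addn0.
have k_gt0 : (0 < k)%N by apply: leq_trans lt_jk.
pose e := (j + i * k.-1)%N; rewrite -/e in Du.
exists ((e%:R * u + X 1 * deriv u) * m - i.+1%:R * u * (k%:R * m + X 1 * deriv m)).
split.
  (* Multiplying by [X] avoids the exponent [e - 1] when [e = 0]. *)
  have X1 : X 1 != 0.
    by apply/eqP => /(congr1 (@^~ 1%N))/eqP; rewrite /fps_of_poly coefXn fps0 oner_eq0.
  apply: (fps_mulfI X1); rewrite /= Du mulrBr.
  have -> : X 1 * (deriv (X e * u) * (X k * m)) = X (e + k) * ((e%:R * u + X 1 * deriv u) * m).
    by rewrite mulrA deriv_mulXn exprD rmorphM; ring.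
  have -> : X 1 * (i.+1%:R * (X e * u) * deriv (X k * m)) =
      X (e + k) * (i.+1%:R * u * (k%:R * m + X 1 * deriv m)).
    by rewrite mulrCA deriv_mulXn exprD rmorphM; ring.
  rewrite -mulrBr [RHS]mulrA -rmorphM -exprD; congr (X _ * _).
  by rewrite /e mulSn; lia.
have X10 : X 1 0%N = 0 by rewrite /fps_of_poly coefXn.
rewrite fpsD fpsN !(fps_mulC0, fpsD, fps_nat0) X10 !mul0r !addr0.
have -> : e%:R * u 0%N * m 0%N - i.+1%:R * u 0%N * (k%:R * m 0%N) =
  - (u 0%N * m 0%N * ((i.+1 * k)%N%:R - e%:R)) by rewrite natrM; ring.
have lt_e : (e < i.+1 * k)%N by rewrite /e mulSn; nia.
by rewrite oppr_eq0 !mulf_neq0 // -natrB 1?ltnW // pnatr_eq0 subn_eq0 -ltnNge.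
Qed.

(** A quotient with a pole cannot solve an equation that is regular at the
    pole: the term of highest order is the only one of lowest valuation. *)
Lemma quot_op_pole l r (k j : nat) m n :
  (j < k)%N -> m 0%N != 0 -> n 0%N != 0 -> l r 0%N != 0 ->
  quot_op l r (X j * n) (X k * m) <> 0.
Proof.
move=> lt_jk m0 n0 lr0.
have /choice[u uP] i := quot_num_order i lt_jk m0 n0.
pose E := (j + r * k.-1)%N => /(congr1 (@^~ E)).
have termE (i : nat) : (i <= r)%N -> (l i * quot_num (X j * n) (X k * m) i * (X k * m) ^+ (r - i)) =
    X (E + (r - i)) * (l i * u i * m ^+ (r - i)).
  move=> le_ir; have [-> _] := uP i; rewrite exprMn -rmorphXn -exprM.
  have -> : (E + (r - i) = (j + i * k.-1) + k * (r - i))%N.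
    by rewrite /E; nia.
  rewrite [in RHS]exprD rmorphM /=; ring.
rewrite /quot_op fps_sum big_ord_recr /= big1 ?add0r => [|i _]; last first.
  rewrite termE ?(ltnW (ltn_ord i)) // fps_mulXn ifT //.
  by have := ltn_ord i; lia.
rewrite termE // subnn addn0 fps_mulXn ltnn subnn expr0 mulr1 fps_mulC0.
have [_ ur] := uP r; by move/eqP; rewrite mulf_eq0 (negPf lr0) (negPf ur).
Qed.

Lemma quot_op_regular l r m n :
  m != 0 -> l r 0%N != 0 -> quot_op l r n m = 0 ->
  exists k m' n', [/\ m = X k * m', m' 0%N != 0 & n = X k * n'].
Proof.
move=> /fps_ordP[k [m' [Dm m'0]]] lr0 qop.
have [n0|/fps_ordP[j [n' [Dn n'0]]]] := eqVneq n 0.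
  by exists k, m', 0; rewrite n0 mulr0.
have [lt_jk|le_kj] := ltnP j k.
  by case: (quot_op_pole lt_jk m'0 n'0 lr0); rewrite -Dm -Dn.
exists k, m', (X (j - k) * n'); split=> //.
by rewrite mulrA -rmorphM -exprD subnKC.
Qed.

End FormalOperator.

(** * The norm of the complex numbers, with values in the reals *)
Section Norm.
Variable R : realType.
Local Notation C := R[i].
Local Notation nm := (@normc R).
Local Notation Re := (@complex.Re R).
Local Notation Im := (@complex.Im R).
Implicit Types (x y z : C) (e r : R).

Lemma norm_nm z : `|z| = (nm z)%:C%C.
Proof. by []. Qed.

Lemma nm_ge0 z : 0 <= nm z.
Proof. by rewrite -lecR -norm_nm normr_ge0. Qed.

Lemma nmD x y : nm (x + y) <= nm x + nm y.
Proof. by rewrite -lecR rmorphD /= -!norm_nm ler_normD. Qed.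

Lemma nmN x : nm (- x) = nm x.
Proof. by apply: complexI; rewrite -!norm_nm normrN. Qed.

Lemma nmB x y : nm (x - y) <= nm x + nm y.
Proof. by rewrite -(nmN y) nmD. Qed.

Lemma nm_distC x y : nm (x - y) = nm (y - x).
Proof. by rewrite -nmN opprB. Qed.

Lemma nm_dist_add y x z : nm (x - z) <= nm (x - y) + nm (y - z).
Proof. by rewrite (le_trans _ (nmD _ _)) // addrA subrK. Qed.

Lemma nm0 : nm 0 = 0.
Proof. by apply: complexI; rewrite -norm_nm normr0. Qed.

Lemma nm1 : nm 1 = 1.
Proof. by apply: complexI; rewrite -norm_nm normr1. Qed.

Lemma nm_eq0 z : (nm z == 0) = (z == 0).
Proof. by rewrite -[z == 0]normr_eq0 norm_nm (fmorph_eq0 (real_complex R)). Qed.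

Lemma nm_gt0 z : (0 < nm z) = (z != 0).
Proof. by rewrite lt_neqAle nm_ge0 andbT eq_sym nm_eq0. Qed.

Lemma nmM x y : nm (x * y) = nm x * nm y.
Proof. by apply: complexI; rewrite rmorphM /= -!norm_nm normrM. Qed.

Lemma nmX x n : nm (x ^+ n) = nm x ^+ n.
Proof. by apply: complexI; rewrite rmorphXn /= -!norm_nm normrX. Qed.

Lemma nmV x : nm x^-1 = (nm x)^-1.
Proof. by apply: complexI; rewrite fmorphV /= -!norm_nm normfV. Qed.

Lemma nmMn x n : nm (x *+ n) = nm x *+ n.
Proof. by apply: complexI; rewrite rmorphMn /= -!norm_nm normrMn. Qed.

Lemma nm_real r : nm r%:C%C = `|r|.
Proof. by rewrite /normc /= expr0n addr0 sqrtr_sqr. Qed.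

Lemma nm_sum I s (P : pred I) (f : I -> C) :
  nm (\sum_(i <- s | P i) f i) <= \sum_(i <- s | P i) nm (f i).
Proof.
elim/big_rec2: _ => [|i a b _ le_ba]; first by rewrite nm0.
by rewrite (le_trans (nmD _ _)) // lerD2l.
Qed.

Lemma nm_Re z : `|Re z| <= nm z.
Proof. by rewrite -lecR -norm_nm normc_ge_Re. Qed.

Lemma nm_le_ReIm z : nm z <= `|Re z| + `|Im z|.
Proof.
rewrite {1}[z]complexE (le_trans (nmD _ _)) // nmM !nm_real.
by rewrite (_ : nm 'i%C = 1) ?mul1r // /normc /= expr0n expr1n add0r sqrtr1.
Qed.

Lemma nm_Im z : `|Im z| <= nm z.
Proof.
have := nm_Re (z * 'i%C); rewrite ReiNIm normrN nmM.
by rewrite (_ : nm 'i%C = 1) ?mulr1 // /normc /= expr0n expr1n add0r sqrtr1.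
Qed.

Lemma near_nmP z0 (P : C -> Prop) :
  (\forall z \near z0, P z) <-> exists2 e, 0 < e & forall z, nm (z - z0) < e -> P z.
Proof.
split.
  move/nbhs_ballP => [e e0 eP]; have e0' : 0 < Re e by move: e0; rewrite /= ltcE => /andP[].
  exists (Re e) => // z ze; apply: eP; rewrite /ball /= distrC norm_nm.
  have -> : e = (Re e)%:C%C by rewrite RRe_real // gtr0_real.
  by rewrite ltcR.
move=> [e e0 eP]; apply/nbhs_ballP; exists e%:C%C; first by rewrite /= ltcR.
by move=> z; rewrite /ball /= distrC norm_nm ltcR; apply: eP.
Qed.

Lemma dnear_nmP z0 (P : C -> Prop) :
  (\forall z \near z0^', P z) <->
  exists2 e, 0 < e & forall z, nm (z - z0) < e -> z != z0 -> P z.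
Proof. exact: near_nmP. Qed.

Lemma cvg_nmP (T : Type) (F : set_system T) {FF : Filter F} (u : T -> C) (l : C) :
  u @ F --> l <-> forall e, 0 < e -> \forall t \near F, nm (u t - l) < e.
Proof.
split=> [/cvgrPdist_lt ul e e0|ul].
  have := ul e%:C%C; rewrite ltcR => /(_ e0); apply: filterS => t.
  by rewrite norm_nm ltcR nm_distC.
apply/cvgrPdist_lt => e e0; have eE : e = (Re e)%:C%C by rewrite RRe_real // gtr0_real.
have /ul : 0 < Re e by rewrite -ltcR -eE.
by apply: filterS => t; rewrite nm_distC norm_nm eE ltcR.
Qed.

End Norm.

(** * Convergent expansions *)
Section Expansion.
Variable R : realType.
Local Notation C := R[i].
Local Notation nm := (@normc R).
Implicit Types (x z : C) (y : C -> C) (a b : fps C) (r rho : R).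

Definition psum a n x : C := \sum_(i < n) a i * x ^+ i.

(** The estimate of the remainder at every order, uniform on a disc.  It gives
    the convergence of the series to [y] near [z0], and it bounds the
    coefficients geometrically, as two consecutive remainders differ by a term;
    products and inverses are then estimated with finite sums only. *)
Definition expansion_bound (z0 : C) y a (A rho : R) : Prop :=
  forall z n, rho * nm (z - z0) <= 1 ->
    nm (y z - psum a n (z - z0)) <= A * (rho * nm (z - z0)) ^+ n.

Definition expansion (z0 : C) y a : Prop :=
  exists A rho, 0 < rho /\ expansion_bound z0 y a A rho.

Lemma le_geo (u v c : R) : (forall n, u <= v + c * (1 / 2) ^+ n) -> u <= v.
Proof.
move=> le_u; rewrite leNgt; apply/negP => lt_vu.
have d0 : 0 < u - v by rewrite subr_gt0.
have [n] : exists n : nat, `|c| / (u - v) < n%:R.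
  by exists (Num.bound (`|c| / (u - v))); apply: archi_boundP; rewrite divr_ge0 // ltW.
rewrite ltr_pdivrMr // => lt_c.
have n_lt : n%:R <= 2 ^+ n :> R by rewrite -natrX ler_nat ltnW // ltn_expl.
have := le_u n; rewrite expr_div_n expr1n mulrA mulr1 -lerBlDl ler_pdivlMr ?exprn_gt0 //.
have := ler_norm c; nra.
Qed.

Lemma psumS a n x : psum a n.+1 x = psum a n x + a n * x ^+ n.
Proof. by rewrite /psum big_ord_recr. Qed.

Lemma psum0 a x : psum a 0 x = 0. Proof. by rewrite /psum big_ord0. Qed.

Lemma psumD a b n x : psum (a + b) n x = psum a n x + psum b n x.
Proof. by rewrite -big_split; apply: eq_bigr => i _; apply: mulrDl. Qed.

Lemma psumM a b n x :
  psum (a * b) n x = \sum_(i < n) a i * x ^+ i * psum b (n - i) x.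
Proof.
elim: n => [|n IHn]; first by rewrite psum0 big_ord0.
rewrite psumS IHn [RHS]big_ord_recr /= subSnn psumS psum0 expr0 mulr1 add0r.
under [in RHS]eq_bigr => i _ do rewrite subSn ?psumS ?mulrDr ?(ltnW (ltn_ord i)) //.
rewrite big_split -addrA; congr (_ + _).
rewrite fpsM mulr_suml big_ord_recr /= subnn; congr (_ + _); last by ring.
apply: eq_bigr => i _; have -> : x ^+ n = x ^+ i * x ^+ (n - i) by rewrite -exprD subnKC // ltnW.
by ring.
Qed.

Lemma expansion_bound_weaken z0 y a A rho A' rho' :
  0 < rho -> rho <= rho' -> A <= A' -> expansion_bound z0 y a A rho ->
  expansion_bound z0 y a A' rho'.
Proof.
move=> rho0 le_rho le_A ya z n zr.
have nm_ge0' := nm_ge0 (z - z0).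
have le_t : rho * nm (z - z0) <= rho' * nm (z - z0) by apply: ler_wpM2r.
have t_ge0 : 0 <= rho * nm (z - z0) by rewrite mulr_ge0 // ltW.
apply: le_trans (ya z n (le_trans le_t zr)) _.
have A_ge0 : 0 <= A.
  have := ya z0 0%N; rewrite subrr nm0 mulr0 ler01 expr0 mulr1 => /(_ isT).
  by apply: le_trans; apply: nm_ge0.
by apply: ler_pM => //; [apply: exprn_ge0 | apply: lerXn2r; rewrite // nnegrE (le_trans _ le_t)].
Qed.

Lemma expansion_boundP z0 y a : expansion z0 y a -> exists A0 rho0,
  [/\ 0 < A0, 0 < rho0 & forall A rho, A0 <= A -> rho0 <= rho -> expansion_bound z0 y a A rho].
Proof.
move=> [A [rho [rho0 ya]]]; exists (`|A| + 1), rho; split=> //.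
move=> A' rho' le_A le_rho; apply: expansion_bound_weaken ya => //.
by rewrite (le_trans _ le_A) // (le_trans (ler_norm _)) // lerDl.
Qed.

Lemma expansion_common z0 y1 a1 y2 a2 :
  expansion z0 y1 a1 -> expansion z0 y2 a2 -> exists A rho,
  [/\ 0 < A, 0 < rho, expansion_bound z0 y1 a1 A rho & expansion_bound z0 y2 a2 A rho].
Proof.
move=> /expansion_boundP[A1 [r1 [A10 r10 H1]]] /expansion_boundP[A2 [r2 [A20 r20 H2]]].
exists (A1 + A2), (r1 + r2); split; rewrite ?addr_gt0 //.
  by apply: H1; rewrite lerDl ltW.
by apply: H2; rewrite lerDr ltW.
Qed.

Lemma near_rho (z0 : C) rho (P : C -> Prop) : 0 < rho ->
  (forall z, rho * nm (z - z0) <= 1 -> P z) -> \forall z \near z0, P z.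
Proof.
move=> rho0 HP; apply/near_nmP; exists rho^-1; first by rewrite invr_gt0.
by move=> z zr; apply: HP; rewrite mulrC -ler_pdivlMr // div1r ltW.
Qed.

Lemma near_rhoP (z0 : C) (P : C -> Prop) : (\forall z \near z0, P z) ->
  exists2 rho0, 0 < rho0 & forall rho, rho0 <= rho -> forall z, rho * nm (z - z0) <= 1 -> P z.
Proof.
move=> /near_nmP[e e0 HP]; exists (2 / e); first by rewrite divr_gt0.
move=> rho le_rho z zr; apply: HP.
have rho0 : 0 < rho by apply: lt_le_trans le_rho; rewrite divr_gt0.
rewrite -(ltr_pM2l rho0); apply: le_lt_trans zr _.
rewrite -ltr_pdivrMr // div1r; apply: lt_le_trans le_rho.
by rewrite ltr_pMl ?invr_gt0 // ltr1n.
Qed.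

Lemma expansion_near z0 y1 y2 a :
  (\forall z \near z0, y1 z = y2 z) -> expansion z0 y1 a -> expansion z0 y2 a.
Proof.
move=> /near_rhoP[r r0 eq_y] /expansion_boundP[A [rho [A0 rho0 ya]]].
exists A, (r + rho); split; first exact: addr_gt0.
move=> z n zr; rewrite -(eq_y (r + rho)) ?lerDl ?(ltW rho0) //.
by apply: ya => //; rewrite lerDr ltW.
Qed.

Lemma expansion_eq z0 y1 y2 a : y1 =1 y2 -> expansion z0 y1 a -> expansion z0 y2 a.
Proof. by move=> eq_y; apply: expansion_near; apply/near_nmP; exists 1 => // z _; apply: eq_y. Qed.

Lemma expansion_value z0 y a : expansion z0 y a -> y z0 = a 0%N.
Proof.
move=> [A [rho [_ ya]]]; have := ya z0 1%N.
rewrite subrr nm0 mulr0 ler01 expr1 mulr0 psumS psum0 expr0 mulr1 add0r => /(_ isT).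
move=> le0; apply/eqP; rewrite -subr_eq0 -nm_eq0 eq_le nm_ge0 andbT.
exact: le0.
Qed.

Lemma psum_term z0 y a A rho z i : expansion_bound z0 y a A rho ->
  rho * nm (z - z0) <= 1 -> 0 < rho -> 0 < A ->
  nm (a i * (z - z0) ^+ i) <= 2 * A * (rho * nm (z - z0)) ^+ i.
Proof.
move=> ya zr rho0 A0; have t_ge0 : 0 <= rho * nm (z - z0) by rewrite mulr_ge0 ?nm_ge0 // ltW.
have -> : a i * (z - z0) ^+ i =
  (y z - psum a i (z - z0)) - (y z - psum a i.+1 (z - z0)) by rewrite psumS; ring.
apply: le_trans (nmB _ _) _; have H1 := ya z i zr; have H2 := ya z i.+1 zr.
have : (rho * nm (z - z0)) ^+ i.+1 <= (rho * nm (z - z0)) ^+ i.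
  by rewrite exprS ler_piMl // exprn_ge0.
move: H1 H2; set s := _ ^+ i; set s' := _ ^+ i.+1; nra.
Qed.

Lemma expansion_coef z0 y a A rho i : expansion_bound z0 y a A rho ->
  0 < rho -> 0 < A -> nm (a i) <= 2 * A * rho ^+ i.
Proof.
move=> ya rho0 A0; pose z := z0 + (rho^-1)%:C%C.
have zE : z - z0 = (rho^-1)%:C%C by rewrite /z addrC addKr.
have nmz : nm (z - z0) = rho^-1 by rewrite zE nm_real ger0_norm // invr_ge0 ltW.
have := psum_term i ya; move=> /(_ z); rewrite nmz mulfV ?gt_eqF // lexx => /(_ isT rho0 A0).
rewrite nmM nmX nmz expr1n mulr1 exprVn ler_pdivrMr ?exprn_gt0 //.
Qed.

Lemma leq_2n1 n : (2 * n + 1 <= 2 * 2 ^ n)%N.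
Proof. by elim: n => // n IHn; rewrite expnS; lia. Qed.

Lemma expansionD z0 y1 a1 y2 a2 : expansion z0 y1 a1 -> expansion z0 y2 a2 ->
  expansion z0 (fun z => y1 z + y2 z) (a1 + a2).
Proof.
move=> H1 H2; have [A [rho [A0 rho0 {}H1 {}H2]]] := expansion_common H1 H2.
exists (A + A), rho; split=> // z n zr; rewrite psumD mulrDl opprD addrACA.
by apply: le_trans (nmD _ _) _; apply: lerD; [apply: H1 | apply: H2].
Qed.

(** [psumM] splits the remainder of a product into the products of the terms of
    the first series with the remainders of the second, up to one remainder of
    the first; there are [2 n + 1 <= 2 * 2 ^ n] bounds of equal size, hence the
    doubling of [rho]. *)
Lemma expansionM z0 y1 a1 y2 a2 : expansion z0 y1 a1 -> expansion z0 y2 a2 ->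
  expansion z0 (fun z => y1 z * y2 z) (a1 * a2).
Proof.
move=> H1 H2; have [A [rho [A0 rho0 {}H1 {}H2]]] := expansion_common H1 H2.
exists (2 * A ^+ 2), (2 * rho); split; first by rewrite mulr_gt0.
move=> z n zr; set x := z - z0 in zr *; pose t := rho * nm x.
have t_ge0 : 0 <= t by rewrite mulr_ge0 ?nm_ge0 // ltW.
have t_le1 : t <= 1 by move: zr; rewrite -mulrA -/t; nra.
have -> : y1 z * y2 z - psum (a1 * a2) n x =
    \sum_(i < n) a1 i * x ^+ i * (y2 z - psum a2 (n - i) x) + (y1 z - psum a1 n x) * y2 z.
  under [in RHS]eq_bigr do rewrite mulrBr.
  by rewrite psumM sumrB -mulr_suml -/(psum a1 n x); ring.
have -> : (2 * rho * nm x) ^+ n = 2 ^+ n * t ^+ n by rewrite -mulrA exprMn.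
have le_sum : nm (\sum_(i < n) a1 i * x ^+ i * (y2 z - psum a2 (n - i) x)) <= (2 * A ^+ 2 * t ^+ n) *+ n.
  apply: le_trans (nm_sum _ _ _) _; rewrite -[X in _ *+ X]card_ord -sumr_const.
  apply: ler_sum => i _; rewrite nmM.
  have := psum_term i H1 t_le1 rho0 A0; have := H2 z (n - i)%N t_le1; rewrite -/x -/t => h2 h1.
  apply: le_trans (ler_pM (nm_ge0 _) (nm_ge0 _) h1 h2) _.
  have -> : t ^+ n = t ^+ i * t ^+ (n - i) by rewrite -exprD subnKC // ltnW.
  lra.
have le_last : nm ((y1 z - psum a1 n x) * y2 z) <= A ^+ 2 * t ^+ n.
  have h1 := H1 z n t_le1; have := H2 z 0%N t_le1; rewrite psum0 subr0 expr0 mulr1 => h2.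
  rewrite nmM; apply: le_trans (ler_pM (nm_ge0 _) (nm_ge0 _) h1 h2) _.
  by rewrite -/x -/t; lra.
apply: le_trans (nmD _ _) _; apply: le_trans (lerD le_sum le_last) _.
rewrite -mulr_natr.
have : (2 * n + 1)%N%:R <= (2 * 2 ^ n)%N%:R :> R by rewrite ler_nat leq_2n1.
rewrite natrD !natrM natrX.
have : 0 <= A ^+ 2 * t ^+ n by rewrite mulr_ge0 ?exprn_ge0 // ltW.
move: (t ^+ n) (2 ^+ n) => s u; nra.
Qed.

Lemma expansionC z0 c : expansion z0 (fun=> c) (fps_of_poly c%:P).
Proof.
exists (nm c), 1; split=> // z [|n] _; first by rewrite psum0 subr0 expr0 mulr1.
rewrite (_ : psum _ _ _ = c) ?subrr ?nm0 ?mulr_ge0 ?exprn_ge0 ?mulr_ge0 ?nm_ge0 //.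
by rewrite /psum -(@horner_coef_wide _ n.+1) ?hornerC // size_polyC; case: eqP.
Qed.

Lemma expansionN z0 y a : expansion z0 y a -> expansion z0 (fun z => - y z) (- a).
Proof.
move=> /(expansionM (expansionC z0 (- 1))).
rewrite polyCN rmorphN rmorph1 mulN1r; apply: expansion_eq => z.
by rewrite mulN1r.
Qed.

Lemma expansionX z0 : expansion z0 id (taylor z0 'X).
Proof.
rewrite taylorX; exists (1 + nm z0), 1; split=> // z n; rewrite mul1r => zr.
have [z0_ge0 x_ge0] := (nm_ge0 z0, nm_ge0 (z - z0)).
case: n => [|[|n]].
- rewrite psum0 subr0 expr0 mulr1 -{1}[z](subrK z0); apply: le_trans (nmD _ _) _.
  by rewrite lerD2r.
- rewrite psumS psum0 /fps_of_poly coefD coefX coefC expr0 mulr1 !add0r expr1.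
  by rewrite ler_peMl // lerDl.
have -> : psum (fps_of_poly ('X + z0%:P)) n.+2 (z - z0) = z.
  transitivity (('X + z0%:P).[z - z0]); last by rewrite !hornerE subrK.
  by rewrite (@horner_coef_wide _ n.+2) ?size_XaddC.
by rewrite subrr nm0 mulr_ge0 ?addr_ge0 ?exprn_ge0.
Qed.

Lemma expansion_poly z0 (p : {poly C}) : expansion z0 (fun z => p.[z]) (taylor z0 p).
Proof.
elim/poly_ind: p => [|p c IHp].
  by rewrite rmorph0 -(rmorph0 (@fps_of_poly C)) -polyC0; apply: expansion_eq (expansionC _ _) => z; rewrite horner0.
rewrite rmorphD rmorphM /= taylorC.
apply: expansion_eq (expansionD (expansionM IHp (expansionX z0)) (expansionC z0 c)) => z.
by rewrite hornerMXaddC.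
Qed.

(** [P.[v%:P].[z]] is the value of [P(z, Y)] at [Y = v]. *)
Lemma expansion_horner z0 y a (P : {poly {poly C}}) : expansion z0 y a ->
  expansion z0 (fun z => P.[(y z)%:P].[z]) (map_poly (taylor z0) P).[a].
Proof.
move=> ya; elim/poly_ind: P => [|P p IHP].
  rewrite rmorph0 horner0 -(rmorph0 (taylor z0)).
  by apply: expansion_eq (expansion_poly z0 0) => z; rewrite !horner0.
rewrite rmorphD rmorphM /= map_polyX map_polyC hornerMXaddC.
apply: expansion_eq (expansionD (expansionM IHP ya) (expansion_poly z0 p)) => z.
by rewrite hornerMXaddC hornerD hornerM hornerC.
Qed.

Lemma expansion_sum z0 n (y : 'I_n -> C -> C) (a : 'I_n -> fps C) :
    (forall i, expansion z0 (y i) (a i)) ->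
  expansion z0 (fun z => \sum_(i < n) y i z) (\sum_(i < n) a i).
Proof.
move=> ya; elim: n => [|n IHn] in y a ya *.
  rewrite big_ord0 -(rmorph0 (taylor z0)).
  by apply: expansion_eq (expansion_poly z0 0) => z; rewrite !horner0 big_ord0.
rewrite big_ord_recr.
apply: expansion_eq (expansionD (IHn _ _ (fun i => ya (widen_ord (leqnSn n) i))) (ya ord_max)) => z.
by rewrite big_ord_recr.
Qed.

(** ** Zeros *)

(** Near [z0] the lowest nonzero term dominates the remainder. *)
Lemma expansion_isolated z0 y a : expansion z0 y a -> a != 0 ->
  \forall z \near z0, z != z0 -> y z != 0.
Proof.
move=> /expansion_boundP[A [rho [A0 rho0 ya]]] /fps_ordP[k [u [Da u0]]].
have ak : a k = u 0%N by rewrite Da fps_mulXn ltnn subnn.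
have akx x : psum a k.+1 x = u 0%N * x ^+ k.
  rewrite psumS ak /psum big1 ?add0r // => i _.
  by rewrite Da fps_mulXn ltn_ord mul0r.
have nu0 : 0 < nm (u 0%N) by rewrite nm_gt0.
have Ark0 : 0 < A * rho ^+ k.+1 by rewrite mulr_gt0 ?exprn_gt0.
(* The second summand is the inverse of the radius at which the bound of the
   remainder is half of the lowest term. *)
pose rho1 := rho + 2 * A * rho ^+ k.+1 / nm (u 0%N).
have rho10 : 0 < rho1 by rewrite addr_gt0 // divr_gt0 // -mulrA mulr_gt0.
apply: (near_rho rho10) => z; set x := z - z0 => zr zz0.
have x0 : 0 < nm x by rewrite nm_gt0 subr_eq0.
apply/eqP => yz0.
have le1 : rho * nm x <= 1.
  apply: le_trans zr; rewrite ler_wpM2r ?nm_ge0 // lerDl ltW // divr_gt0 // -mulrA mulr_gt0 //.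
have := ya A rho (lexx _) (lexx _) z k.+1 le1.
rewrite -/x yz0 akx sub0r nmN nmM nmX exprMn [nm x ^+ k.+1]exprS !mulrA.
rewrite ler_pM2r ?exprn_gt0 // => le2.
have : 2 * A * rho ^+ k.+1 / nm (u 0%N) * nm x <= 1.
  by apply: le_trans zr; rewrite ler_wpM2r ?nm_ge0 // lerDr ltW.
rewrite mulrAC ler_pdivrMr // mul1r.
have : 0 < A * rho ^+ k.+1 * nm x by rewrite mulr_gt0.
move: le2; set s := nm x; rewrite -!mulrA [rho ^+ k.+1 * s]mulrC.
rewrite ![A * _]mulrA; move: (A * s * _) => v; lra.
Qed.

Lemma punctured_point z0 (P : C -> Prop) :
  (\forall z \near z0, z != z0 -> P z) -> exists2 z, z != z0 & P z.
Proof.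
move=> /near_nmP[e e0 HP]; exists (z0 + (e / 2)%:C%C).
  by rewrite addrC -subr_eq0 addrK (fmorph_eq0 (real_complex R)) gt_eqF // divr_gt0.
apply: HP; rewrite [z0 + _]addrC ?addrK.
  by rewrite nm_real ger0_norm ?ltr_pdivrMr ?ltr_pMr // ?ltr1n // divr_ge0 // ltW.
by rewrite -subr_eq0 addrK (fmorph_eq0 (real_complex R)) gt_eqF // divr_gt0.
Qed.

Lemma expansion_eq0 z0 a : expansion z0 (fun=> 0) a -> a = 0.
Proof.
move=> ya; apply/eqP/negPn/negP => a0.
by have [z _ /eqP] := punctured_point (expansion_isolated ya a0).
Qed.

Lemma expansion_unique z0 y a b : expansion z0 y a -> expansion z0 y b -> a = b.
Proof.
move=> ya /expansionN yb; apply/eqP; rewrite -subr_eq0; apply/eqP.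
apply: (@expansion_eq0 z0); apply: expansion_eq (expansionD ya yb) => z.
by rewrite subrr.
Qed.

Lemma expansion_near0 z0 y : expansion z0 y 0 -> \forall z \near z0, y z = 0.
Proof.
move=> [A [rho [rho0 ya]]].
have rho20 : 0 < 2 * rho by rewrite mulr_gt0.
apply: (near_rho rho20) => z zr; apply/eqP; rewrite -nm_eq0 eq_le nm_ge0 andbT.
have t_ge0 : 0 <= rho * nm (z - z0) by rewrite mulr_ge0 ?nm_ge0 ?ltW.
have t_le : rho * nm (z - z0) <= 1 / 2 by rewrite -mulrA in zr; lra.
apply: (@le_geo _ _ A) => n; rewrite add0r.
have A_ge0 : 0 <= A.
  have := ya z 0%N; rewrite psum0 subr0 expr0 mulr1 => H.
  by apply: le_trans (nm_ge0 _) (H _); lra.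
have := ya z n; rewrite (_ : psum 0 n _ = 0) ?subr0; last first.
  by rewrite /psum big1 // => i _; rewrite mul0r.
move=> H; apply: le_trans (H _) _; first by lra.
by rewrite ler_wpM2l // lerXn2r // nnegrE //; lra.
Qed.

(** ** Quotients *)

(** At [z0] itself the quotient takes the value prescribed by the series. *)
Lemma expansion_divX z0 y b : expansion z0 y (fps_of_poly 'X^1 * b) ->
  exists y', expansion z0 y' b /\ forall z, y z = (z - z0) * y' z.
Proof.
set a := _ * b => ya.
have a0 : a 0%N = 0 by rewrite /a fps_mulXn.
have aS n : a n.+1 = b n by rewrite /a fps_mulXn /= subn1.
exists (fun z => if z == z0 then b 0%N else y z / (z - z0)); split; last first.
  move=> z; case: eqP => [->|/eqP zz0]; first by rewrite subrr mul0r (expansion_value ya).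
  by rewrite mulrCA mulfV ?mulr1 // subr_eq0.
have psum_a n x : psum a n.+1 x = x * psum b n x.
  rewrite /psum big_ord_recl a0 mul0r add0r mulr_sumr; apply: eq_bigr => i _.
  by rewrite lift0 aS exprS mulrCA.
have [A [rho [A0 rho0 {}ya]]] := expansion_boundP ya.
exists (A * rho + nm (b 0%N)), rho; split=> // z n zr.
have Ar0 : 0 <= A * rho by rewrite mulr_ge0 // ltW.
have b0 := nm_ge0 (b 0%N).
case: eqP => [->|/eqP zz0].
  rewrite subrr nm0 mulr0; case: n => [|n].
    by rewrite psum0 subr0 expr0 mulr1 lerDr.
  rewrite /psum big_ord_recl /= expr0 mulr1 big1 ?addr0 ?subrr ?nm0 ?expr0n ?mulr0 // => i _.
  by rewrite expr0n (_ : (_ == 0%N) = false) ?mulr0.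
have x0 : z - z0 != 0 by rewrite subr_eq0.
have nx0 : 0 < nm (z - z0) by rewrite nm_gt0.
have -> : y z / (z - z0) - psum b n (z - z0) = (y z - psum a n.+1 (z - z0)) / (z - z0).
  by rewrite psum_a; field.
rewrite nmM nmV ler_pdivrMr //.
have := ya A rho (lexx _) (lexx _) z n.+1 zr; move/le_trans; apply.
have : 0 <= nm (b 0%N) * (rho * nm (z - z0)) ^+ n * nm (z - z0).
  by rewrite !mulr_ge0 ?exprn_ge0 ?mulr_ge0 ?nm_ge0 // ltW.
rewrite exprS; lra.
Qed.

Lemma expansion_divXn z0 k y b : expansion z0 y (fps_of_poly 'X^k * b) ->
  exists y', expansion z0 y' b /\ forall z, y z = (z - z0) ^+ k * y' z.
Proof.
elim: k y b => [|k IHk] y b.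
  by rewrite expr0 rmorph1 mul1r => yb; exists y; split=> // z; rewrite expr0 mul1r.
rewrite exprS rmorphM -mulrA => /expansion_divX[y1 [/IHk[y2 [y2b y12]] y01]].
by exists y2; split=> // z; rewrite y01 y12 exprS mulrA.
Qed.

(** The coefficients of the inverse are defined by recursion on all the previous
    ones, which the sequence keeps. *)
Fixpoint fps_inv_seq (m : fps C) n : seq C :=
  if n is k.+1 then let s := fps_inv_seq m k in
    rcons s ((m 0%N)^-1 * ((k == 0%N)%:R - \sum_(i < k) nth 0 s i * m (k - i)%N))
  else [::].

Definition fps_inv m : fps C := fun n => nth 0 (fps_inv_seq m n.+1) n.

Lemma size_fps_inv_seq m n : size (fps_inv_seq m n) = n.
Proof. by elim: n => //= n IHn; rewrite size_rcons IHn. Qed.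

Lemma nth_fps_inv_seq m n i : (i < n)%N -> nth 0 (fps_inv_seq m n) i = fps_inv m i.
Proof.
elim: n => // n IHn; rewrite ltnS leq_eqVlt => /orP[/eqP->//|lt_in].
by rewrite /= nth_rcons size_fps_inv_seq lt_in IHn.
Qed.

Lemma fps_invE m n : fps_inv m n =
  (m 0%N)^-1 * ((n == 0%N)%:R - \sum_(i < n) fps_inv m i * m (n - i)%N).
Proof.
rewrite {1}/fps_inv /= nth_rcons size_fps_inv_seq ltnn eqxx.
by under eq_bigr => i _ do rewrite nth_fps_inv_seq //.
Qed.

Lemma fps_invM m : m 0%N != 0 -> fps_inv m * m = 1.
Proof.
move=> m0; apply/funext => n; rewrite fpsM big_ord_recr /= subnn [fps_inv m n]fps_invE.
rewrite mulrAC mulVf // mul1r addrC subrK.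
by rewrite -[RHS]/((1 : {poly C})`_n) coef1.
Qed.

Lemma geometric_sum (s : R) n : \sum_(i < n) s * (1 + s) ^+ i = (1 + s) ^+ n - 1.
Proof.
elim: n => [|n IHn]; first by rewrite big_ord0 expr0 subrr.
by rewrite big_ord_recr IHn /= exprS; ring.
Qed.

(** With [nm (m i) <= B rho ^ i] and [q = nm (m 0)], the recursion [fps_invE]
    bounds the coefficients of the inverse by [q^-1 (rho (1 + B / q)) ^ i]: the sum
    of the earlier bounds is a geometric sum ([geometric_sum]) of exactly this
    size. *)
Lemma expansionV z0 y m : expansion z0 y m -> m 0%N != 0 ->
  expansion z0 (fun z => (y z)^-1) (fps_inv m).
Proof.
move=> /expansion_boundP[A1 [rho [A10 rho0 ym]]] m0.
have {}ym := ym A1 rho (lexx _) (lexx _).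
pose q := nm (m 0%N); have q0 : 0 < q by rewrite nm_gt0.
pose B := 2 * A1; have B0 : 0 < B by rewrite mulr_gt0.
have mB i : nm (m i) <= B * rho ^+ i by apply: expansion_coef ym _ _.
(* [s >= 1] because the bound of order [0] reads [q <= B]. *)
pose s := B / q.
have s1 : 1 <= s by rewrite ler_pdivlMr // mul1r; have := mB 0%N; rewrite expr0 mulr1.
pose sigma := rho * (1 + s).
have sigma0 : 0 < sigma by rewrite mulr_gt0 //; lra.
have eB n : nm (fps_inv m n) <= q^-1 * sigma ^+ n.
  elim/ltn_ind: n => n IHn; rewrite fps_invE nmM nmV ler_wpM2l ?invr_ge0 ?nm_ge0 //.
  case: n IHn => [|n] IHn; first by rewrite big_ord0 subr0 nm1 expr0.
  rewrite sub0r nmN; apply: le_trans (nm_sum _ _ _) _.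
  apply: (@le_trans _ _ (\sum_(i < n.+1) rho ^+ n.+1 * (s * (1 + s) ^+ i))).
    apply: ler_sum => i _; rewrite nmM.
    apply: le_trans (ler_pM (nm_ge0 _) (nm_ge0 _) (IHn _ (ltn_ord i)) (mB _)) _.
    have -> : rho ^+ n.+1 = rho ^+ i * rho ^+ (n.+1 - i) by rewrite -exprD subnKC // ltnW.
    rewrite /sigma /s exprMn le_eqVlt; apply/orP; left; apply/eqP.
    by field; rewrite gt_eqF.
  rewrite -mulr_sumr geometric_sum /sigma exprMn ler_wpM2l ?exprn_ge0 ?ltW //.
  by rewrite ltrBlDr ltrDl.
exists (2 / q * s), (2 * sigma); split; first by rewrite mulr_gt0.
move=> z n; set x := z - z0 => zr.
pose t := sigma * nm x.
have t_ge0 : 0 <= t by rewrite mulr_ge0 ?nm_ge0 // ltW.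
have t_le : t <= 1 / 2 by move: zr; rewrite -mulrA -/t; lra.
have le_rs : rho * nm x <= t.
  by rewrite /t /sigma -mulrA ler_pM2l // ler_peMl ?nm_ge0 //; lra.
have r_ge0 : 0 <= rho * nm x by rewrite mulr_ge0 ?nm_ge0 // ltW.
have rs_le : s * (rho * nm x) <= 1 / 2.
  by move: t_le r_ge0; rewrite /t /sigma; lra.
have yz : q / 2 <= nm (y z).
  have := ym z 1%N (le_trans le_rs (le_trans t_le _)); rewrite psumS psum0 add0r expr0 mulr1 expr1 => H.
  have {}H : nm (y z - m 0%N) <= q / 2.
    apply: le_trans (H _) _; first by lra.
    move: rs_le; rewrite /s mulrAC ler_pdivrMr // /B -/x; nra.
  have : q <= nm (y z) + nm (y z - m 0%N).
    rewrite /q -{1}[m 0%N](subKr (y z)); exact: nmB.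
  lra.
have y0 : y z != 0 by rewrite -nm_gt0; lra.
have -> : (2 * sigma * nm x) ^+ n = 2 ^+ n * t ^+ n by rewrite -mulrA exprMn.
have -> : (y z)^-1 - psum (fps_inv m) n x = (y z)^-1 * (1 - y z * psum (fps_inv m) n x).
  by rewrite mulrBr mulr1 mulKf.
rewrite nmM -[X in _ <= X](mulrA (2 / q)).
apply: ler_pM; rewrite ?nm_ge0 //.
  by rewrite nmV -[2 / q]invf_div lef_pV2 // posrE ?nm_gt0 // divr_gt0.
case: n => [|n]; first by rewrite psum0 mulr0 subr0 nm1 !expr0 !mulr1.
have -> : 1 - y z * psum (fps_inv m) n.+1 x =
    - \sum_(i < n.+1) fps_inv m i * x ^+ i * (y z - psum m (n.+1 - i) x).
  under eq_bigr do rewrite mulrBr.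
  rewrite sumrB -psumM fps_invM // -mulr_suml -/(psum (fps_inv m) n.+1 x).
  have -> : psum 1 n.+1 x = 1.
    by rewrite -[RHS](hornerC 1 x) (@horner_coef_wide _ n.+1) ?size_poly1.
  by ring.
rewrite nmN; apply: le_trans (nm_sum _ _ _) _.
apply: (@le_trans _ _ ((s * t ^+ n.+1) *+ n.+1)).
  rewrite -[X in _ *+ X]card_ord -sumr_const; apply: ler_sum => i _.
  rewrite !nmM nmX.
  have H := ym z (n.+1 - i)%N (le_trans le_rs (le_trans t_le _)).
  apply: (@le_trans _ _ (q^-1 * sigma ^+ i * nm x ^+ i * (A1 * t ^+ (n.+1 - i)))).
    apply: ler_pM; rewrite ?mulr_ge0 ?exprn_ge0 ?nm_ge0 ?ler_wpM2r ?exprn_ge0 ?nm_ge0 //.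
    apply: le_trans (H _) _; first by lra.
    by rewrite ler_wpM2l ?(ltW A10) // lerXn2r // nnegrE.
  have -> : t ^+ n.+1 = t ^+ i * t ^+ (n.+1 - i) by rewrite -exprD subnKC // ltnW.
  have -> : q^-1 * sigma ^+ i * nm x ^+ i * (A1 * t ^+ (n.+1 - i)) =
    A1 / q * (t ^+ i * t ^+ (n.+1 - i)) by rewrite [t ^+ i]exprMn; ring.
  rewrite ler_wpM2r ?mulr_ge0 ?exprn_ge0 // /s /B ler_pM2r ?invr_gt0 //; lra.
rewrite -mulr_natr -mulrA ler_wpM2l // 1?(le_trans _ s1) // mulrC ler_wpM2r ?exprn_ge0 //.
by rewrite -natrX ler_nat ltnW // ltn_expl.
Qed.

(** A common factor [X^k] is cancelled first, on both sides of the quotient. *)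
Lemma expansion_quotient z0 w yn ym n m k :
    expansion z0 yn (fps_of_poly 'X^k * n) -> expansion z0 ym (fps_of_poly 'X^k * m) ->
    m 0%N != 0 -> (\forall z \near z0, ym z * w z = yn z) -> w z0 = (n * fps_inv m) 0%N ->
  expansion z0 w (n * fps_inv m).
Proof.
move=> /expansion_divXn[n' [n'n nE]] ymm m0; have [m' [m'm mE]] := expansion_divXn ymm.
move=> wE w0; have q'q := expansionM n'n (expansionV m'm m0).
apply: expansion_near q'q.
have m'0 : m != 0 by apply: contraNneq m0 => ->.
have := expansion_isolated m'm m'0.
apply: filterS2 wE => z wE mz; have [->|zz0] := eqVneq z z0.
  by rewrite w0 (expansion_value n'n) (expansion_value (expansionV m'm m0)) fps_mulC0.
apply: (@mulfI _ ((z - z0) ^+ k * m' z)).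
  by rewrite mulf_neq0 ?mz // expf_neq0 // subr_eq0.
rewrite -[in RHS]mE wE nE; field; exact: mz.
Qed.
End Expansion.

(** * Analytic functions *)
Section Analytic.
Variable R : realType.
Local Notation C := R[i].
Local Notation nm := (@normc R).
Local Notation Re := (@complex.Re R).
Local Notation Im := (@complex.Im R).
Implicit Types (x z : C) (y : C -> C) (a b : fps C) (r rho : R).

Lemma geometric_tail (t : nat -> C) A theta : 0 <= A -> 0 <= theta -> theta <= 1 / 2 ->
    (forall i, nm (t i) <= A * theta ^+ i) ->
  forall m n, (n <= m)%N ->
    nm (\sum_(i < m) t i - \sum_(i < n) t i) <= 2 * A * theta ^+ n.
Proof.
move=> A0 th0 th2 tA m n le_nm.
suff : nm (\sum_(i < m) t i - \sum_(i < n) t i) <= 2 * A * theta ^+ n - 2 * A * theta ^+ m.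
  have : 0 <= 2 * A * theta ^+ m by rewrite !mulr_ge0 ?exprn_ge0.
  lra.
elim: m le_nm => [|m IHm].
  by rewrite leqn0 => /eqP ->; rewrite subrr nm0 subrr.
rewrite leq_eqVlt => /orP[/eqP <-|]; first by rewrite !subrr nm0.
rewrite ltnS => /IHm le_m; rewrite big_ord_recr /= addrAC.
apply: le_trans (nmD _ _) _; have := tA m; rewrite exprS.
have : 0 <= A * theta ^+ m * (1 - 2 * theta).
  by rewrite !mulr_ge0 ?exprn_ge0 //; lra.
move: le_m; lra.
Qed.

Lemma geometric_sum_exists (t : nat -> C) A theta : 0 <= A -> 0 <= theta -> theta <= 1 / 2 ->
    (forall i, nm (t i) <= A * theta ^+ i) ->
  exists s, forall n, nm (s - \sum_(i < n) t i) <= 2 * A * theta ^+ n.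
Proof.
move=> A0 th0 th2 tA.
have cv (f : C -> R) : (forall z, `|f z| <= nm z) -> cvgn (series (fun i => f (t i))).
  move=> fle; apply: (@normed_cvg _ R^o).
  apply: (@series_le_cvg _ _ (geometric A theta)).
  - by move=> n /=; rewrite normr_ge0.
  - by move=> n /=; rewrite mulr_ge0 ?exprn_ge0.
  - by move=> n /=; apply: le_trans (fle _) (tA n).
  - by apply: is_cvg_geometric_series; rewrite ger0_norm //; lra.
have /cvg_ex[u cu] := cv Re (@nm_Re R); have /cvg_ex[v cv'] := cv Im (@nm_Im R).
exists (u +i* v)%C => n; apply/ler_addgt0Pr => e e0.
have e20 : 0 < e / 2 by rewrite divr_gt0.
have /cvgrPdist_lt/(_ _ e20)[N1 _ HN1] := cu; have /cvgrPdist_lt/(_ _ e20)[N2 _ HN2] := cv'.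
pose m := (n + (N1 + N2))%N.
have Hu := HN1 m; have Hv := HN2 m; rewrite /= /series /= in Hu Hv.
have {}Hu := Hu ltac:(rewrite /m; lia); have {}Hv := Hv ltac:(rewrite /m; lia).
have le_nm : (n <= m)%N by rewrite leq_addr.
apply: le_trans (nm_dist_add (\sum_(i < m) t i) _ _) _.
rewrite addrC; apply: lerD; first exact: geometric_tail.
have ReS : forall k, Re (\sum_(i < k) t i) = \sum_(0 <= i < k) Re (t i).
  by move=> k; rewrite big_mkord (raddf_sum (Re : {additive Rcomplex R -> R})).
have ImS : forall k, Im (\sum_(i < k) t i) = \sum_(0 <= i < k) Im (t i).
  by move=> k; rewrite big_mkord (raddf_sum (Im : {additive Rcomplex R -> R})).
apply: le_trans (nm_le_ReIm _) _; rewrite (splitr e) ltW // ltrD //.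
  have -> (x : C) : Re ((u +i* v)%C - x) = u - Re x by case: x.
  by rewrite ReS.
have -> (x : C) : Im ((u +i* v)%C - x) = v - Im x by case: x.
by rewrite ImS.
Qed.

(** [analytic_on] only asks for pointwise convergence near [z0]; one point of
    convergence other than [z0] makes it geometric on a smaller disc. *)
Lemma expansion_of_cvg (z0 : C) y a :
  (\forall z \near z0, series (fun n => a n * (z - z0) ^+ n) @ \oo --> y z) -> expansion z0 y a.
Proof.
move=> ya; have [z1 z10 ya1] : exists2 z1, z1 != z0 & series (fun n => a n * (z1 - z0) ^+ n) @ \oo --> y z1.
  by apply: punctured_point; apply: filterS ya => z Hz _.
pose r := nm (z1 - z0); have r0 : 0 < r by rewrite nm_gt0 subr_eq0.
have [A A0 aA] : exists2 A, 0 < A & forall n, nm (a n) * r ^+ n <= A.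
  have /cvg_nmP/(_ _ ltr01)[N _ HN] := ya1.
  pose T n := nm (a n) * r ^+ n.
  exists (2 + \sum_(i < N) T i) => [|n].
    by rewrite ltr_wpDr // sumr_ge0 // => i _; rewrite mulr_ge0 ?exprn_ge0 ?nm_ge0.
  have T_ge0 i : 0 <= T i by rewrite mulr_ge0 ?exprn_ge0 ?nm_ge0.
  have [lt_nN|le_Nn] := ltnP n N.
    rewrite (bigD1 (Ordinal lt_nN)) //= -/(T n) addrCA lerDl addr_ge0 // sumr_ge0 //.
  have := HN n.+1 (leqW le_Nn); have := HN n le_Nn; rewrite /= /series /= !big_mkord big_ord_recr /=.
  set S := \sum_(_ < _) _; set l := y z1 => H1 H2.
  have sum_ge0 : 0 <= \sum_(i < N) T i by rewrite sumr_ge0.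
  have : nm (a n * (z1 - z0) ^+ n) <= nm (S + a n * (z1 - z0) ^+ n - l) + nm (S - l).
    by rewrite (le_trans _ (nmB _ _)) // opprB addrA subrK addrC addKr.
  rewrite nmM nmX -/r; lra.
have [rho0 rho00 near_y] := near_rhoP ya.
pose rho := rho0 + 2 / r.
have rho_gt0 : 0 < rho by rewrite addr_gt0 // divr_gt0.
exists (2 * A), rho; split=> // z n zr; pose t := nm (z - z0) / r.
have le_t : 2 * t <= rho * nm (z - z0).
  have : 0 <= rho0 * nm (z - z0) by rewrite mulr_ge0 ?nm_ge0 // ltW.
  by rewrite /t /rho; lra.
have t_ge0 : 0 <= t by rewrite divr_ge0 ?nm_ge0 // ltW.
have cvz := near_y rho (ltac:(by rewrite lerDl divr_ge0 // ltW)) z zr.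
apply: (@le_trans _ _ (2 * A * t ^+ n)); last first.
  by rewrite ler_wpM2l ?mulr_ge0 ?(ltW A0) // lerXn2r ?nnegrE //; lra.
apply/ler_addgt0Pr => e e0; have /cvg_nmP/(_ e e0)[N _ HN] := cvz.
pose m := (n + N)%N; have := HN m (leq_addl _ _); rewrite /= /series /= big_mkord nm_distC => Hm.
apply: le_trans (nm_dist_add (\sum_(i < m) a i * (z - z0) ^+ i) _ _) _.
rewrite addrC; apply: lerD; last exact: ltW.
apply: (@geometric_tail (fun i => a i * (z - z0) ^+ i) A t); rewrite ?leq_addr ?(ltW A0) //; first by lra.
move=> i; rewrite nmM nmX /t exprMn exprVn mulrA ler_pdivlMr ?exprn_gt0 // mulrAC.
by rewrite ler_wpM2r ?exprn_ge0 ?nm_ge0.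
Qed.

Lemma cvg_of_expansion (z0 : C) y a : expansion z0 y a ->
  \forall z \near z0, series (fun n => a n * (z - z0) ^+ n) @ \oo --> y z.
Proof.
move=> [A [rho [rho0 ya]]]; have rho20 : 0 < 2 * rho by rewrite mulr_gt0.
apply: (near_rho rho20) => z zr; apply/cvg_nmP => e e0.
have t_ge0 : 0 <= rho * nm (z - z0) by rewrite mulr_ge0 ?nm_ge0 ?ltW.
have t_le : rho * nm (z - z0) <= 1 / 2 by rewrite -mulrA in zr; lra.
have A_ge0 : 0 <= A.
  have := ya z 0%N; rewrite psum0 subr0 expr0 mulr1 => H.
  by apply: le_trans (nm_ge0 _) (H _); lra.
have ge0 : 0 <= A / e by rewrite divr_ge0 // ltW.
exists (Num.bound (A / e)) => // n /= le_n; rewrite /series /= big_mkord nm_distC.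
apply: le_lt_trans (ya z n _) _; first by lra.
apply: (@le_lt_trans _ _ (A * (1 / 2) ^+ n)).
  by rewrite ler_wpM2l // lerXn2r // nnegrE //; lra.
rewrite expr_div_n expr1n mulrA mulr1 ltr_pdivrMr ?exprn_gt0 // mulrC -ltr_pdivrMr //.
apply: lt_le_trans (archi_boundP ge0) _; rewrite -natrX ler_nat.
by apply: leq_trans le_n _; rewrite ltnW // ltn_expl.
Qed.

Lemma analytic_onP (U : set C) y :
  analytic_on U y <-> forall z, U z -> exists a, expansion z y a.
Proof.
split=> [ya z /ya[a az]|ya z /ya[a az]]; exists a; first exact: expansion_of_cvg.
exact: cvg_of_expansion.
Qed.

(** ** Derivatives *)

Lemma nm_powB x z r i : 0 < r -> nm x <= r -> nm z <= r ->
  nm (x ^+ i - z ^+ i) <= nm (x - z) * ((2 * r) ^+ i / r).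
Proof.
move=> r0 xr zr; elim: i => [|i IHi].
  by rewrite subrr nm0 mulr_ge0 ?nm_ge0 // divr_ge0 ?expr0 // ltW.
have -> : x ^+ i.+1 - z ^+ i.+1 = x * (x ^+ i - z ^+ i) + (x - z) * z ^+ i by rewrite !exprS; ring.
apply: le_trans (nmD _ _) _; rewrite !nmM nmX.
have h1 : nm x * nm (x ^+ i - z ^+ i) <= r * (nm (x - z) * ((2 * r) ^+ i / r)).
  by apply: ler_pM; rewrite ?nm_ge0.
have h2 : nm z ^+ i <= r ^+ i by rewrite lerXn2r ?nnegrE ?nm_ge0 // ltW.
have h3 : r ^+ i <= (2 * r) ^+ i by rewrite lerXn2r ?nnegrE ?mulr_ge0 ?ltW //; lra.
have h4 : nm (x - z) * nm z ^+ i <= nm (x - z) * (2 * r) ^+ i.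
  by rewrite ler_wpM2l ?nm_ge0 // (le_trans h2).
apply: le_trans (lerD h1 h4) _; rewrite exprS.
set u := (2 * r) ^+ i; set v := nm (x - z).
have -> : v * (2 * r * u / r) = 2 * (v * u) by field; rewrite gt_eqF.
have -> : r * (v * (u / r)) = v * u by field; rewrite gt_eqF.
lra.
Qed.

(** The error of the affine approximation of a power, with a bound of the form
    [nm (x - z) ^ 2] times a geometric term. *)
Lemma nm_pow_taylor x z r i : 0 < r -> nm x <= r -> nm z <= r ->
  nm (x ^+ i.+1 - z ^+ i.+1 - (x - z) * (z ^+ i *+ i.+1))
    <= nm (x - z) ^+ 2 * ((4 * r) ^+ i.+1 / r ^+ 2).
Proof.
move=> r0 xr zr; elim: i => [|i IHi].
  rewrite !expr1 expr0 mulr1n mulr1 subrr nm0 mulr_ge0 ?exprn_ge0 ?nm_ge0 // divr_ge0 ?exprn_ge0 ?mulr_ge0 // ltW //.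
have -> : x ^+ i.+2 - z ^+ i.+2 - (x - z) * (z ^+ i.+1 *+ i.+2) =
   z * (x ^+ i.+1 - z ^+ i.+1 - (x - z) * (z ^+ i *+ i.+1)) + (x - z) * (x ^+ i.+1 - z ^+ i.+1).
  rewrite [z ^+ i.+1 *+ i.+2]mulrS -![z ^+ _ *+ i.+1]mulr_natr !exprS; ring.
apply: le_trans (nmD _ _) _; rewrite !nmM.
have h1 := ler_pM (nm_ge0 _) (nm_ge0 _) zr IHi.
have h2 := ler_wpM2l (nm_ge0 (x - z)) (nm_powB i.+1 r0 xr zr).
apply: le_trans (lerD h1 h2) _.
have h3 : (2 * r) ^+ i.+1 <= (4 * r) ^+ i.+1 by rewrite lerXn2r ?nnegrE ?mulr_ge0 ?ltW //; lra.
rewrite [(4 * r) ^+ i.+2]exprS; set u := (4 * r) ^+ i.+1 in h3 *.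
set u' := (2 * r) ^+ i.+1 in h3 *; set v := nm (x - z).
have -> : r * (v ^+ 2 * (u / r ^+ 2)) + v * (v * (u' / r)) = v ^+ 2 * (u + u') / r.
  by field; rewrite gt_eqF.
have -> : v ^+ 2 * (4 * r * u / r ^+ 2) = v ^+ 2 * (4 * u) / r by field; rewrite gt_eqF.
rewrite ler_wpM2r ?invr_ge0 ?(ltW r0) // ler_wpM2l ?exprn_ge0 ?nm_ge0 //.
have : 0 <= u by rewrite exprn_ge0 // mulr_ge0 // ltW.
lra.
Qed.

Lemma derive1_quadratic y z l A e : 0 < e ->
    (forall w, nm (w - z) < e -> nm (y w - y z - (w - z) * l) <= A * nm (w - z) ^+ 2) ->
  y^`()%classic z = l.
Proof.
move=> e0 yl; rewrite /derive1; apply: cvg_lim; first exact: norm_hausdorff.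
apply/cvg_nmP => d d0; apply/dnear_nmP.
pose A' := `|A| + 1; have A'0 : 0 < A' by rewrite ltr_wpDl.
pose e' := Num.min e (d / A').
exists e'; first by rewrite lt_min e0 divr_gt0.
move=> h; rewrite subr0 lt_min => /andP[he hd] h0.
have -> : h^-1 *: (y (h + z) - y z) - l = h^-1 * (y (h + z) - y z - (h + z - z) * l).
  by rewrite addrK mulrBr mulKf.
have nh0 : 0 < nm h by rewrite nm_gt0.
rewrite nmM nmV mulrC ltr_pdivrMr //.
have := yl (h + z); rewrite addrK => /(_ he) /le_lt_trans; apply.
rewrite ltr_pdivlMr // in hd.
have : A <= `|A| by apply: ler_norm.
rewrite expr2 mulrA ltr_pM2r // => leA; rewrite mulrC in hd.
apply: le_lt_trans hd; rewrite /A'; nra.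
Qed.

(** The affine approximation of [y] at a point near [z0] is the sum of those of
    the terms of the series, whose errors add up to a multiple of the square of
    the increment. *)
Lemma expansion_deriv (z0 : C) y a : expansion z0 y a ->
  expansion z0 (y^`()%classic) (fps_deriv a).
Proof.
move=> /expansion_boundP[A [rho [A0 rho0 ya]]].
have {}ya := ya A rho (lexx _) (lexx _).
pose B := 2 * A; have B0 : 0 < B by rewrite mulr_gt0.
have aB i : nm (a i) <= B * rho ^+ i by apply: expansion_coef ya _ _.
(* On the disc of radius [r], the series of [y], that of its derivative and the
   bounds of [nm_pow_taylor] are dominated by a geometric series of ratio
   [1 / 2]. *)
pose r := (8 * rho)^-1; have r0 : 0 < r by rewrite invr_gt0 mulr_gt0.
have rE : 8 * rho * r = 1 by rewrite /r mulfV // gt_eqF // mulr_gt0.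
have daB i : nm (fps_deriv a i) <= B * rho * (2 * rho) ^+ i.
  rewrite nmMn -[_ *+ i.+1]mulr_natr; apply: (@le_trans _ _ (B * rho ^+ i.+1 * 2 ^+ i)).
    by rewrite ler_pM ?nm_ge0 // -natrX ler_nat ltn_expl.
  by rewrite exprMn exprS; lra.
have [dy dyP] : exists dy : C -> C, forall z, nm (z - z0) <= r -> forall n,
    nm (dy z - psum (fps_deriv a) n (z - z0)) <= 2 * (B * rho) * (2 * rho * nm (z - z0)) ^+ n.
  have /choice[dy dyP] : forall z, exists s, nm (z - z0) <= r -> forall n,
      nm (s - psum (fps_deriv a) n (z - z0)) <= 2 * (B * rho) * (2 * rho * nm (z - z0)) ^+ n.
    move=> z; have [zr|_] := boolP (nm (z - z0) <= r); last by exists 0.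
    have [||||s sP] := @geometric_sum_exists (fun i => fps_deriv a i * (z - z0) ^+ i)
        (B * rho) (2 * rho * nm (z - z0)).
    - by rewrite mulr_ge0 // ltW.
    - by rewrite !mulr_ge0 ?nm_ge0 // ltW.
    - by have := nm_ge0 (z - z0); nra.
    - move=> i; rewrite nmM nmX exprMn mulrA; apply: ler_wpM2r => //.
      by rewrite exprn_ge0 ?nm_ge0.
    by exists s.
  by exists dy.
have small z : nm (z - z0) <= r -> rho * nm (z - z0) <= 1 / 8.
  move=> /(ler_wpM2l (ltW rho0)) /le_trans; apply; move: rE; lra.
have ytail z n : nm (z - z0) <= r -> nm (y z - psum a n (z - z0)) <= A * (1 / 2) ^+ n.
  move=> /small zr; have t_ge0 : 0 <= rho * nm (z - z0) by rewrite mulr_ge0 ?nm_ge0 ?(ltW rho0).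
  apply: le_trans (ya z n _) _; first by lra.
  by rewrite ler_wpM2l ?(ltW A0) // lerXn2r ?nnegrE //; lra.
have dytail z n : nm (z - z0) <= r ->
    nm (dy z - psum (fps_deriv a) n (z - z0)) <= 2 * (B * rho) * (1 / 2) ^+ n.
  move=> zr; have t_ge0 : 0 <= rho * nm (z - z0) by rewrite mulr_ge0 ?nm_ge0 ?(ltW rho0).
  apply: le_trans (dyP z zr n) _; rewrite ler_wpM2l ?mulr_ge0 ?(ltW A0) ?(ltW rho0) //.
  by have le_t := small z zr; rewrite lerXn2r ?nnegrE -?mulrA //; lra.
have diff_term w z i : nm (w - z0) <= r -> nm (z - z0) <= r ->
    nm (psum a i (w - z0) - psum a i (z - z0) - (w - z) * psum (fps_deriv a) i.-1 (z - z0))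
      <= (B / r ^+ 2) * nm (w - z) ^+ 2 * (1 - (1 / 2) ^+ i).
  move=> wr zr; case: i => [|i].
    by rewrite !psum0 subrr mulr0 subrr nm0 expr0 subrr mulr0.
  rewrite [i.+1.-1]/=.
  pose T j := a j.+1 * ((w - z0) ^+ j.+1 - (z - z0) ^+ j.+1 - (w - z) * ((z - z0) ^+ j *+ j.+1)).
  have -> : psum a i.+1 (w - z0) - psum a i.+1 (z - z0)
      - (w - z) * psum (fps_deriv a) i (z - z0) = \sum_(j < i) T j.
    rewrite /psum !big_ord_recl !expr0 mulr_sumr opprD addrACA subrr add0r -!sumrB.
    apply: eq_bigr => j _; rewrite /T lift0 /fps_deriv mulrnAl -mulrnAr; ring.
  have Tj j : nm (T j) <= B / r ^+ 2 * nm (w - z) ^+ 2 * ((1 / 2) ^+ j.+1).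
    rewrite nmM; have := nm_pow_taylor j r0 wr zr.
    rewrite (_ : w - z0 - (z - z0) = w - z); last by ring.
    move=> /(ler_pM (nm_ge0 _) (nm_ge0 _) (aB j.+1)) /le_trans; apply.
    have h4 : rho * (4 * r) = 1 / 2.
      by have -> : rho * (4 * r) = (8 * rho * r) / 2; [field | rewrite rE].
    rewrite -h4.
    by rewrite [(rho * _) ^+ _]exprMn; lra.
  apply: le_trans (nm_sum _ _ _) _; 
  apply: (@le_trans _ _ (\sum_(j < i) B / r ^+ 2 * nm (w - z) ^+ 2 * (1 / 2) ^+ j.+1)).
    by apply: ler_sum => j _; apply: Tj.
  rewrite -mulr_sumr ler_wpM2l ?mulr_ge0 ?invr_ge0 ?exprn_ge0 ?nm_ge0 ?(ltW A0) ?(ltW r0) //.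
  have -> : \sum_(j < i) (1 / 2) ^+ j.+1 = 1 - (1 / 2) ^+ i :> R.
    elim: i => [|i IHi]; first by rewrite big_ord0 expr0 subrr.
    by rewrite big_ord_recr /= IHi exprS; field.
  have : 0 <= (1 / 2 : R) ^+ i by rewrite exprn_ge0 // divr_ge0.
  by rewrite exprS; set u := _ ^+ i; lra.
have derivE z : nm (z - z0) < r -> y^`()%classic z = dy z.
  move=> zr; apply: (@derive1_quadratic _ _ _ (B / r ^+ 2) (r - nm (z - z0))).
    by rewrite subr_gt0.
  move=> w wz; have wr : nm (w - z0) <= r.
    by apply: le_trans (nm_dist_add z _ _) _; lra.
  have {}zr := ltW zr.
  apply: (@le_geo _ _ _ (2 * A + nm (w - z) * (2 * (B * rho)))) => n.
  pose S := psum a n.+1 (w - z0) - psum a n.+1 (z - z0) - (w - z) * psum (fps_deriv a) n (z - z0).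
  have -> : y w - y z - (w - z) * dy z = S + ((y w - psum a n.+1 (w - z0))
     - (y z - psum a n.+1 (z - z0)) - (w - z) * (dy z - psum (fps_deriv a) n (z - z0))).
    by rewrite /S; ring.
  have h0 := diff_term w z n.+1 wr zr; rewrite -/S in h0.
  have h1 := ytail w n.+1 wr; have h2 := ytail z n.+1 zr; have h3 := dytail z n zr.
  have h3' := ler_wpM2l (nm_ge0 (w - z)) h3.
  apply: le_trans (nmD _ _) _; apply: lerD.
    apply: le_trans h0 _; apply: ler_piMr.
      by rewrite mulr_ge0 ?exprn_ge0 ?nm_ge0 // divr_ge0 ?exprn_ge0 ?(ltW r0) // ltW.
    by rewrite gerBl exprn_ge0 // divr_ge0.
  apply: le_trans (nmB _ _) _; apply: le_trans (lerD (nmB _ _) (lexx _)) _.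
  rewrite nmM; rewrite exprS in h1 h2.
  have : 0 <= A * (1 / 2) ^+ n by rewrite mulr_ge0 ?(ltW A0) // exprn_ge0 // divr_ge0.
  move: h1 h2 h3'; set u := _ ^+ n; lra.
exists (2 * (B * rho)), (16 * rho); split; first by rewrite mulr_gt0.
move=> z n zr; have x_ge0 := nm_ge0 (z - z0).
have zr' : nm (z - z0) < r.
  by rewrite -(@ltr_pM2l _ (8 * rho)) ?mulr_gt0 // rE; lra.
rewrite derivE //; apply: le_trans (dyP z (ltW zr') n) _.
have t_ge0 : 0 <= rho * nm (z - z0) by rewrite mulr_ge0 ?(ltW rho0).
rewrite ler_wpM2l ?mulr_ge0 ?(ltW A0) ?(ltW rho0) //.
by rewrite lerXn2r ?nnegrE -?mulrA //; lra.
Qed.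

End Analytic.

(** * Analytic continuation and algebraic points *)
Section Domains.
Variable R : realType.
Local Notation C := R[i].
Local Notation nm := (@normc R).

Definition pathwise_connected (U : set C) : Prop :=
  forall x z : C, U x -> U z -> exists g : R -> C,
    [/\ {within `[0, 1], continuous g}, g @` `[0, 1] `<=` U, g 0 = x & g 1 = z].

(** Along a path, the points near which [y] vanishes form an open and closed
    set, as the zeros of a nonzero series are isolated. *)
Lemma identity_theorem (U : set C) (y : C -> C) (z0 : C) :
    pathwise_connected U ->
    (forall z, U z -> exists a, expansion z y a) ->
    U z0 -> expansion z0 y 0 ->
  forall z, U z -> expansion z y 0.
Proof.
move=> pathU yU Uz0 yz0 z Uz.
have [g [gc gU g0 g1]] := pathU z0 z Uz0 Uz.
pose Z := interior [set w | y w = 0].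
have in01 (t : R) : 0 <= t -> t <= 1 -> `[0, 1]%classic t by move=> t0 t1; rewrite /= in_itv /= t0.
have A_conn : connected (g @` `[0, 1]).
  by apply: connected_continuous_connected gc; apply: segment_connected.
have Zg : g @` `[0, 1] `&` Z = g @` `[0, 1].
  apply: A_conn.
  - exists z0; split; first by exists 0; rewrite ?g0 //; apply: in01.
    exact: expansion_near0 yz0.
  - by exists Z => //; apply: open_interior.
  exists (~` (interior (~` Z))); first by apply: open_closedC; apply: open_interior.
  apply/seteqP; split=> w [Aw].
    by move=> Zw; split=> // /interior_subset; apply.
  move=> nZw; split=> //; apply: contrapT => nZ.
  have [a ya] := yU w (gU _ Aw).
  have a0 : a != 0.
    by apply/eqP => a0; apply: nZ; apply: expansion_near0; rewrite -a0.
  apply: nZw; have := expansion_isolated ya a0.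
  apply: filterS => w' yw' Zw'; have y0 := interior_subset Zw'.
  have [ww'|ww'] := eqVneq w' w; first by apply: nZ; rewrite -ww'.
  by have := yw' ww'; rewrite y0 eqxx.
have Zz : Z z.
  have : (g @` `[0, 1]) z by exists 1; rewrite ?g1 //; apply: in01.
  by rewrite -Zg => -[].
have [a ya] := yU z Uz; suff -> : (0 : fps C) = a by [].
by apply/esym/(@expansion_eq0 _ z); apply: expansion_near ya.
Qed.

(** [iota] is the identity on the rational numbers and maps ['i] to a square
    root of [-1], so its image contains a dense set of points. *)
Lemma rmorph_algC_dense (iota : {rmorphism algC -> C}) (U : set C) :
  open U -> U !=set0 -> exists k, U (iota k).
Proof.
move=> oU [z Uz]; have /near_nmP[e e0 zU] := open_nbhs_nbhs (conj oU Uz).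
have iE : iota 'i = 'i%C \/ iota 'i = - 'i%C.
  have : (iota 'i) ^+ 2 = ('i%C : C) ^+ 2 by rewrite -rmorphXn /= sqrCi rmorphN1 sqr_i.
  by move/eqP; rewrite eqf_sqr => /orP[]/eqP; [left|right].
have e20 : 0 < e / 2 by rewrite divr_gt0.
have rat_near (x : R) : exists q : rat, `|ratr q - x| < e / 2.
  have [q] := @rat_in_itvoo R (x - e / 2) (x + e / 2) ltac:(lra).
  by rewrite in_itv /= => /andP[q1 q2]; exists q; rewrite ltr_norml; apply/andP; split; lra.
have [p pP] := rat_near (complex.Re z).
have realE (q : rat) : iota (ratr q) = (ratr q : R)%:C%C.
  by rewrite (fmorph_rat iota) (fmorph_rat (real_complex R)).
suff [q qP] : exists q : rat, nm (iota 'i * (ratr q : R)%:C%C - 'i%C * (complex.Im z)%:C%C) < e / 2.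
  exists (ratr p + 'i * ratr q); apply: zU; rewrite rmorphD (rmorphM iota 'i) !realE.
  rewrite {1}[z]complexE opprD addrACA; apply: le_lt_trans (nmD _ _) _.
  rewrite [e]splitr ltrD // -rmorphB nm_real //.
have nmi : nm ('i%C : C) = 1 by rewrite /normc /= expr0n expr1n add0r sqrtr1.
case: iE => ->.
  have [q qP] := rat_near (complex.Im z); exists q.
  by rewrite -mulrBr nmM nmi mul1r -rmorphB nm_real.
have [q qP] := rat_near (- complex.Im z); exists q.
by rewrite mulNr -opprD -mulrDr nmN nmM nmi mul1r -rmorphD nm_real -[complex.Im z]opprK.
Qed.

End Domains.

(** * Clearing denominators *)
Section ClearDenominators.
Variables (F C : fieldType) (j : {rmorphism F -> C}).
Implicit Types (q : {fraction {poly F}}) (p d : {poly F}) (z : C).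
Local Notation tofrac := (@FracField.tofrac {poly F}).
Local Notation ev p z := ((map_poly j p).[z]).

Lemma rat_num_den q d p : tofrac d * q = tofrac p -> d * rat_num q = p * rat_den q.
Proof.
move=> dq; have den0 : tofrac (rat_den q) != 0 by rewrite tofrac_eq0 rat_den_neq0.
apply/eqP; rewrite -(tofrac_eq (_ * _)) !tofracM -dq -mulrA; apply/eqP; congr (_ * _).
by rewrite {2}(rat_numden q) divfK.
Qed.

(** [rat_eval] refers to the reduced form; away from the poles, any other
    representation [p / d] gives the same value. *)
Lemma rat_evalP q d p z : tofrac d * q = tofrac p -> ~ rat_pole j q z ->
  ev d z * rat_eval j q z = ev p z.
Proof.
move=> /rat_num_den/(congr1 (fun r => ev r z)); rewrite !rmorphM /= !hornerM => H /negP nz.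
by rewrite /rat_eval mulrA H mulfK.
Qed.

Lemma not_rat_pole q d p z : tofrac d * q = tofrac p -> ev d z != 0 -> ~ rat_pole j q z.
Proof.
move=> /rat_num_den/(congr1 (fun r => ev r z)); rewrite !rmorphM /= !hornerM => H dz pz.
have nz : root (map_poly j (rat_num q)) z.
  by move/eqP: H; rewrite (rootP pz) mulr0 mulf_eq0 (negPf dz).
have := coprimep_rat q; rewrite -(coprimep_map j) => /coprimep_root/(_ nz).
by rewrite -rootE pz.
Qed.

(** The product of the reduced denominators: as it vanishes only at poles, it
    stays invertible at the regular points of an equation. *)
Lemma common_denominator n (q : nat -> {fraction {poly F}}) : exists d (p : nat -> {poly F}),
  [/\ d != 0, forall i, (i < n)%N -> tofrac d * q i = tofrac (p i)
    & forall z, (forall i, ~ rat_pole j (q i) z) -> ev d z != 0].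
Proof.
elim: n => [|n [d [p [d0 dq dz]]]].
  by exists 1, (fun=> 0); split=> // [|z _]; rewrite ?oner_neq0 // rmorph1 hornerC oner_neq0.
exists (d * rat_den (q n)), (fun i => if (i < n)%N then p i * rat_den (q n) else d * rat_num (q n)).
split=> [|i|z qz]; first by rewrite mulf_neq0 // rat_den_neq0.
  rewrite ltnS leq_eqVlt => /orP[/eqP ->|lt_in].
    rewrite ltnn !tofracM {2}(rat_numden (q n)) -mulrA; congr (_ * _).
    by rewrite mulrC divfK // tofrac_eq0 rat_den_neq0.
  by rewrite lt_in !tofracM -(dq i) // mulrAC.
by rewrite rmorphM hornerM mulf_neq0 ?dz //; apply/negP/(qz n).
Qed.

Lemma horner_map2 (P : {poly {poly F}}) n v z : (size P <= n)%N ->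
  (map_poly (map_poly j) P).[v%:P].[z] = \sum_(i < n) ev P`_i z * v ^+ i.
Proof.
move=> sP.
have -> : (map_poly (map_poly j) P).[v%:P] = \sum_(i < n) (map_poly (map_poly j) P)`_i * v%:P ^+ i.
  by rewrite (@horner_coef_wide _ n) //; apply: leq_trans (size_poly _ _) sP.
rewrite horner_sum; apply: eq_bigr => i _.
by rewrite hornerM -rmorphXn hornerC coef_map.
Qed.

End ClearDenominators.

(** The common denominator [d] enters squared on the left: the equation
    multiplied by [d] has polynomial coefficients, and the second factor [d]
    makes it trivial at the zeros of [d], where the hypothesis says nothing. *)
Lemma algebraic_onP (R : realType) (F : fieldType) (j : {rmorphism F -> R[i]})
    (U : set R[i]) (y : R[i] -> R[i]) :
  algebraic_on j U y <-> exists2 P : {poly {poly F}}, P != 0 &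
    forall z, U z -> (map_poly (map_poly j) P).[(y z)%:P].[z] = 0.
Proof.
split=> [[P P0 Py]|[P P0 Py]].
  have [d [p [d0 dP _]]] := common_denominator j (size P) (fun i => P`_i).
  exists (\poly_(i < size P) (d * p i)).
    have lt_P : ((size P).-1 < size P)%N by rewrite ltn_predL size_poly_gt0.
    apply/eqP => /(congr1 (fun Q : {poly {poly F}} => Q`_(size P).-1)).
    rewrite coef_poly lt_P coef0 => /eqP; rewrite mulf_eq0 (negPf d0) /=.
    by rewrite -tofrac_eq0 -dP // mulf_eq0 tofrac_eq0 (negPf d0) lead_coef_eq0 (negPf P0).
  move=> z Uz; rewrite (@horner_map2 _ _ _ _ (size P)) ?size_poly //.
  have [dz|dz] := eqVneq (map_poly j d).[z] 0.
    by rewrite big1 // => i _; rewrite coef_poly ltn_ord rmorphM hornerM dz !mul0r.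
  have nopole i : ~ rat_pole j P`_i z.
    have [lt_iP|le_Pi] := ltnP i (size P); first exact: not_rat_pole (dP i lt_iP) dz.
    apply: (@not_rat_pole _ _ _ _ 1 0); first by rewrite nth_default // mulr0 tofrac0.
    by rewrite rmorph1 hornerC oner_neq0.
  have := congr1 ( *%R ((map_poly j d).[z] ^+ 2)) (Py z Uz nopole).
  rewrite mulr0 mulr_sumr => /(etrans _); apply.
  apply: eq_bigr => i _; rewrite coef_poly ltn_ord rmorphM hornerM.
  by rewrite -(rat_evalP (dP i (ltn_ord i)) (nopole i)); ring.
exists (map_poly (@FracField.tofrac _) P).
  by apply: contraNneq P0 => /polyP P0; apply/eqP/polyP => i; have := P0 i;
     rewrite coef_map !coef0 => /eqP; rewrite tofrac_eq0 => /eqP.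
move=> z Uz nopole; apply: etrans (Py z Uz); rewrite (@horner_map2 _ _ _ _ (size (map_poly (@FracField.tofrac _) P))).
  apply: eq_bigr => i _; rewrite -(@rat_evalP _ _ _ (map_poly (@FracField.tofrac _) P)`_i 1 P`_i) //.
    by rewrite rmorph1 hornerC mul1r.
  by rewrite coef_map tofrac1 mul1r.
by rewrite size_map_inj_poly ?tofrac0 // => a b /eqP; rewrite tofrac_eq => /eqP.
Qed.

Lemma expansion_op (R : realType) (z0 : R[i]) (y : R[i] -> R[i]) (a : fps R[i])
    (p : nat -> {poly R[i]}) r :
  expansion z0 y a ->
  expansion z0 (fun z => \sum_(i < r.+1) (p i).[z] * y^`(i)%classic z)
    (fps_op (fun i => taylor z0 (p i)) r a).
Proof.
move=> ya; apply: (@expansion_sum _ _ r.+1 (fun (i : 'I_r.+1) z => (p i).[z] * y^`(i)%classic z)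
  (fun i => taylor z0 (p i) * iter i (@fps_deriv _) a)) => i.
apply: expansionM; first exact: expansion_poly.
by elim: (nat_of_ord i) => // k IHk; exact: (expansion_deriv IHk).
Qed.

(** * The equation in normalized form *)

(** Normalizing [L] to be monic and clearing denominators gives polynomial
    coefficients [l i] with [l r] nonzero on [U].  The two forms of the equation
    agree outside of finitely many points; a factor [h] that vanishes there and
    cancels in power series removes the exception. *)
Lemma solution_onP (R : realType) (F : fieldType) (j : {rmorphism F -> R[i]})
    (L : diffop F) (U : set R[i]) :
    L != 0 -> open U -> (forall z, U z -> ~ singularity j L z) ->
  exists (r : nat) (l : nat -> {poly F}),
    (forall z, U z -> (map_poly j (l r)).[z] != 0) /\
    (forall y, analytic_on U y -> (solution_on j U L y <->
       forall z, U z -> \sum_(i < r.+1) (map_poly j (l i)).[z] * y^`(i)%classic z = 0)).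
Proof.
move=> L0 oU regL; pose r := (size L).-1.
have size_L : size L = r.+1 by rewrite prednK // size_poly_gt0.
have lead0 : lead_coef L != 0 by rewrite lead_coef_eq0.
have [d [l [d0 dl dz]]] := common_denominator j r.+1 (fun i => L`_i / lead_coef L).
have l_r : l r = d.
  have := dl r (ltnSn r); rewrite -[L`_r]/(lead_coef L) divff // mulr1.
  by move/eqP; rewrite tofrac_eq => /eqP.
have dU z : U z -> (map_poly j d).[z] != 0.
  by move=> /regL Lz; apply: dz => i pi; apply: Lz; exists i.
pose num := rat_num (lead_coef L); pose den := rat_den (lead_coef L).
have dL i : (i < r.+1)%N ->
    FracField.tofrac (d * den) * L`_i = FracField.tofrac (l i * num).
  move=> lt_ir; rewrite !tofracM -(dl i lt_ir) {1}(rat_numden (lead_coef L)) -/num -/den.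
  have num0 : FracField.tofrac num != 0.
    apply: contraNneq lead0 => num0.
    by rewrite (rat_numden (lead_coef L)) -/num num0 mul0r.
  by rewrite invf_div -[RHS]mulrA -[in RHS](mulrA L`_i) divfK // -mulrA [_ * L`_i]mulrC.
have nopole_big i z : (r.+1 <= i)%N -> ~ rat_pole j L`_i z.
  move=> le_ri; apply: (@not_rat_pole _ _ _ _ 1 0); first by rewrite nth_default ?size_L // mulr0 tofrac0.
  by rewrite rmorph1 hornerC oner_neq0.
exists r, l; split=> [z Uz|y /analytic_onP yU]; first by rewrite l_r dU.
have key z : (forall i, ~ rat_pole j L`_i z) ->
    (map_poly j (d * den)).[z] * (\sum_(i < size L) rat_eval j L`_i z * y^`(i)%classic z) =
    (map_poly j num).[z] * \sum_(i < r.+1) (map_poly j (l i)).[z] * y^`(i)%classic z.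
  move=> nopole; rewrite size_L !mulr_sumr; apply: eq_bigr => i _.
  transitivity ((map_poly j (l i * num)).[z] * y^`(i)%classic z).
    by rewrite -(rat_evalP (dL i (ltn_ord i)) (nopole i)) mulrA.
  by rewrite rmorphM hornerM mulrCA mulrA.
split=> [yL z Uz|yl z Uz nopole]; last first.
  apply/eqP; have /eqP := key z nopole; rewrite yl // mulr0 mulf_eq0 => /orP[|//].
  rewrite rmorphM hornerM mulf_eq0 (negPf (dU z Uz)) => /= /eqP den0.
  by case: (nopole r); apply/eqP.
have [a ya] := yU z Uz.
pose S := fun z => \sum_(i < r.+1) (map_poly j (l i)).[z] * y^`(i)%classic z.
have Sa := expansion_op (fun i => map_poly j (l i)) r ya.
(* [h] vanishes at the poles of [L] and at the zeros of its leading
   coefficient. *)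
pose h := map_poly j (d * den * num).
have h0 : h != 0.
  rewrite map_poly_eq0 !mulf_neq0 ?rat_den_neq0 //.
  by apply: contraNneq lead0 => num0; rewrite (rat_numden (lead_coef L)) -/num num0 tofrac0 mul0r.
have hS w : U w -> h.[w] * S w = 0.
  move=> Uw; rewrite /h rmorphM hornerM.
  have [->|dw] := eqVneq (map_poly j (d * den)).[w] 0; first by rewrite !mul0r.
  have nopole i : ~ rat_pole j L`_i w.
    have [lt_ir|] := ltnP i r.+1; first exact: not_rat_pole (dL i lt_ir) dw.
    exact: nopole_big.
  by rewrite -mulrA -key // yL // !mulr0.
have /expansion_eq0/fps_mulf_eq0[/eqP|S0] : expansion z (fun=> 0)
    (taylor z h * fps_op (fun i => taylor z (map_poly j (l i))) r a).
  apply: expansion_near (expansionM (expansion_poly z h) Sa).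
  by have := open_nbhs_nbhs (conj oU Uz); apply: filterS.
  by rewrite -(rmorph0 (taylor z)) (inj_eq (@taylor_inj _ z)) (negPf h0).
by have := expansion_value Sa; rewrite S0.
Qed.

(** * Expansions of the algebraic solutions *)
Section Solutions.
Variables (R : realType) (iota : {rmorphism algC -> R[i]}) (U : set R[i]).
Variables (r : nat) (l : nat -> {poly algC}) (alpha : algC).
Local Notation C := R[i].
Hypotheses (oU : open U) (pathU : pathwise_connected U)
  (Ualpha : U (iota alpha))
  (lr : forall z, U z -> (map_poly iota (l r)).[z] != 0).
Local Notation taylor0 := (taylor (iota alpha)).

Definition local_op z : fps C -> fps C :=
  fps_op (fun i => taylor z (map_poly iota (l i))) r.

Definition extends (y : C -> C) (a : fps C) : Prop :=
  (forall z, U z -> exists b, expansion z y b) /\ expansion (iota alpha) y a.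

(** The space of the descent: by the identity theorem, the equation and the
    algebraicity hold on [U] as soon as they hold for the expansion at
    [iota alpha]. *)
Definition algebraic_solution (a : fps C) : Prop :=
  [/\ exists y, extends y a, local_op (iota alpha) a = 0
    & algebraic_elt taylor0 a].

Lemma taylor0_inj : injective taylor0. Proof. exact: taylor_inj. Qed.
Let domain := @fps_mulf_eq0 C.

Lemma local_opD z a b : local_op z (a + b) = local_op z a + local_op z b.
Proof.
rewrite /local_op /fps_op -big_split; apply: eq_bigr => i _ /=.
rewrite -mulrDr; congr (_ * _); elim: (nat_of_ord i) => //= k IHk.
by rewrite IHk fps_derivD.
Qed.

Lemma local_op0 z : local_op z 0 = 0.
Proof. by apply: (@addrI _ (local_op z 0)); rewrite -local_opD !addr0. Qed.

Lemma local_opM z c a : local_op z (fps_of_poly c%:P * a) = fps_of_poly c%:P * local_op z a.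
Proof.
rewrite /local_op /fps_op mulr_sumr; apply: eq_bigr => i _ /=.
have -> : iter i (@fps_deriv C) (fps_of_poly c%:P * a) = fps_of_poly c%:P * iter i (@fps_deriv C) a.
  elim: (nat_of_ord i) => //= k ->.
  by rewrite fps_derivM fps_deriv_poly derivC rmorph0 mul0r add0r.
by rewrite mulrCA.
Qed.

Lemma algebraic_solutionD a b :
  algebraic_solution a -> algebraic_solution b -> algebraic_solution (a + b).
Proof.
move=> [[y [yU ya]] La alg_a] [[y' [y'U y'b]] Lb alg_b]; split.
- exists (fun z => y z + y' z); split=> [z Uz|]; last exact: expansionD.
  have [c yc] := yU z Uz; have [c' yc'] := y'U z Uz.
  by exists (c + c'); apply: expansionD.
- by rewrite local_opD La Lb addr0.
- exact: (algebraic_eltD taylor0_inj).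
Qed.

Lemma algebraic_solutionM c a :
  algebraic_solution a -> algebraic_solution (fps_of_poly c%:P * a).
Proof.
move=> [[y [yU ya]] La alg_a]; split.
- exists (fun z => c * y z); split=> [z Uz|]; last exact: (expansionM (expansionC _ _)).
  have [b yb] := yU z Uz.
  by exists (fps_of_poly c%:P * b); apply: (expansionM (expansionC _ _)).
- by rewrite local_opM La mulr0.
- rewrite -(taylorC (iota alpha)).
  by apply: (algebraic_eltM taylor0_inj) => //; apply: (algebraic_elt_img taylor0_inj).
Qed.

Fixpoint quot_num_fun (yn ym : C -> C) i : C -> C :=
  if i is k.+1 then fun z =>
    (quot_num_fun yn ym k)^`()%classic z * ym z
      - k.+1%:R * quot_num_fun yn ym k z * ym^`()%classic z
  else yn.

Lemma expansion_quot_num (z : C) yn ym n m i : expansion z yn n -> expansion z ym m ->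
  expansion z (quot_num_fun yn ym i) (quot_num n m i).
Proof.
move=> ynn ymm; elim: i => //= i IHi.
apply: expansionD; first by apply: expansionM => //; apply: expansion_deriv.
apply: expansionN; apply: expansionM; last exact: expansion_deriv.
apply: expansionM => //.
by rewrite -(rmorph_nat (@fps_of_poly C)) -polyC_natr; apply: expansionC.
Qed.

Lemma expansionXn (z : C) (y : C -> C) (a : fps C) k : expansion z y a -> expansion z (fun w => y w ^+ k) (a ^+ k).
Proof.
move=> ya; elim: k => [|k IHk].
  by rewrite expr0 -(rmorph1 (@fps_of_poly C)) -polyC1; apply: expansionC.
by rewrite exprS; apply: expansion_eq (expansionM ya IHk) => w; rewrite exprS.
Qed.

Lemma expansion_quot_op (z : C) yn ym n m : expansion z yn n -> expansion z ym m ->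
  expansion z (fun w => \sum_(i < r.+1) (map_poly iota (l i)).[w] * quot_num_fun yn ym i w * ym w ^+ (r - i))
    (quot_op (fun i => taylor z (map_poly iota (l i))) r n m).
Proof.
move=> ynn ymm; apply: (@expansion_sum _ _ r.+1
  (fun (i : 'I_r.+1) w => (map_poly iota (l i)).[w] * quot_num_fun yn ym i w * ym w ^+ (r - i))
  (fun i => taylor z (map_poly iota (l i)) * quot_num n m i * m ^+ (r - i))) => i.
apply: expansionM; last exact: expansionXn.
by apply: expansionM; [apply: expansion_poly | apply: expansion_quot_num].
Qed.

(** The numerator of the equation for [yn / ym] is analytic on [U] and vanishes
    at the base point, hence everywhere on [U]; so there is no pole, and the
    values of the local quotients define a function on [U]. *)
Lemma extends_quotient yn ym n m a :
    extends yn n -> extends ym m -> m != 0 -> m * a = n -> local_op (iota alpha) a = 0 ->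
  exists y, extends y a.
Proof.
move=> [ynU ynn] [ymU ymm] m0 ma La.
have decomp z : U z -> exists k m' n', [/\ expansion z yn (fps_of_poly 'X^k * n'),
    expansion z ym (fps_of_poly 'X^k * m') & m' 0%N != 0].
  move=> Uz; have [nz ynz] := ynU z Uz; have [mz ymz] := ymU z Uz.
  have mz0 : mz != 0.
    apply: contraNneq m0 => mz0; rewrite mz0 in ymz; apply/eqP.
    exact: expansion_unique ymm (identity_theorem pathU ymU Uz ymz Ualpha).
  have qz : quot_op (fun i => taylor z (map_poly iota (l i))) r nz mz = 0.
    apply: expansion_unique (expansion_quot_op ynz ymz) _.
    have Q0 := expansion_quot_op ynn ymm.
    rewrite (quot_opE _ _ ma) -/(local_op _ _) La mulr0 in Q0.
    apply: identity_theorem Q0 _ Uz => // w Uw.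
    have [nw ynw] := ynU w Uw; have [mw ymw] := ymU w Uw.
    by eexists; apply: (expansion_quot_op ynw ymw).
  have lr0 : taylor z (map_poly iota (l r)) 0%N != 0 by rewrite coef0_taylor lr.
  have [k [m' [n' [Dm m'0 Dn]]]] := quot_op_regular mz0 lr0 qz.
  by exists k, m', n'; rewrite -Dm -Dn.
have /choice[q qP] z : exists q : fps C, U z -> exists k m' n',
    [/\ expansion z yn (fps_of_poly 'X^k * n'),
    expansion z ym (fps_of_poly 'X^k * m'), m' 0%N != 0 & q = n' * fps_inv m'].
  have [Uz|nUz] := pselect (U z); last by exists 0.
  by have [k [m' [n' [? ? ?]]]] := decomp z Uz; exists (n' * fps_inv m') => _; exists k, m', n'.
pose y z := q z 0%N.
have ymy z : U z -> ym z * y z = yn z.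
  move=> Uz; have [k [m' [n' [ynz ymz m'0 qE]]]] := qP z Uz.
  rewrite (expansion_value ynz) (expansion_value ymz) /y qE -fps_mulC0.
  have -> // : fps_of_poly 'X^k * m' * (n' * fps_inv m') = fps_of_poly 'X^k * n'.
  have := fps_invM m'0; rewrite mulrC => E.
  have -> : fps_of_poly 'X^k * m' * (n' * fps_inv m') = fps_of_poly 'X^k * n' * (m' * fps_inv m') by ring.
  by rewrite E mulr1.
have yq z : U z -> expansion z y (q z).
  move=> Uz; have [k [m' [n' [ynz ymz m'0 qE]]]] := qP z Uz.
  rewrite qE; apply: (expansion_quotient ynz ymz) => //; last by rewrite /y qE.
  by have := open_nbhs_nbhs (conj oU Uz); apply: filterS.
exists y; split=> [z Uz|]; first by exists (q z); apply: yq.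
have -> : a = q (iota alpha); last exact: yq.
apply: (fps_mulfI m0); rewrite ma; apply: expansion_unique ynn _.
have eq_y : \forall w \near iota alpha, ym w * y w = yn w.
  by have := open_nbhs_nbhs (conj oU Ualpha); apply: filterS.
by apply: expansion_near eq_y _; apply: expansionM => //; apply: yq.
Qed.

(** The minimal equation [P] of [a] gives
    [P_Y(z, a) D(a) = - P^D(z, a)] with [P_Y(z, a)] nonzero. *)
Lemma algebraic_solution_derivation D a : derivation_over iota D ->
  algebraic_solution a -> algebraic_solution (fps_map D a).
Proof.
move=> derD [[y [yU ya]] La [P0 P00 P0a]].
pose hasz k := `[< exists P : {poly {poly C}}, [/\ P != 0, (map_poly taylor0 P).[a] = 0 & size P = k] >].
have ex_k : exists k, hasz k by exists (size P0); apply/asboolP; exists P0.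
have [k /asboolP[P [P_neq0 Pa size_P]] minP] := ex_minnP ex_k.
have {}minP Q : (map_poly taylor0 Q).[a] = 0 -> (size Q < size P)%N -> Q = 0.
  move=> Qa; rewrite size_P ltnNge => /negP lt_QP; apply/eqP/negPn/negP => Q0; apply: lt_QP.
  by apply: minP; apply/asboolP; exists Q.
have alg_a : algebraic_elt taylor0 a by exists P.
pose m := (map_poly taylor0 P^`()).[a].
pose P1 := - map_poly (map_poly D) P.
pose n := (map_poly taylor0 P1).[a].
have m0 : m != 0.
  apply/eqP => m0; have dP0 : P^`() = 0 by apply: minP => //; apply: lt_size_deriv.
  have P_le1 : (size P <= 1)%N.
    apply/leq_sizeP => -[//|i] _; apply/eqP.
    have /eqP := congr1 (fun Q : {poly {poly C}} => Q`_i) dP0.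
    by rewrite coef_deriv coef0 -mulr_natr -polyC_natr mulf_eq0 polyC_eq0 pnatr_eq0 orbF.
  move: Pa P_neq0; rewrite (size1_polyC P_le1) map_polyC hornerC polyC_eq0.
  by rewrite -(rmorph0 taylor0) => /taylor0_inj ->; rewrite eqxx.
have mDa : m * fps_map D a = n.
  have := fps_map_horner derD alpha P a.
  rewrite Pa (fps_map0 derD) => /esym/eqP; rewrite addrC addr_eq0 => /eqP ->.
  by rewrite /n /P1 rmorphN hornerN.
have LDa : local_op (iota alpha) (fps_map D a) = 0.
  rewrite -(fps_map0 derD) -La /local_op /fps_op (fps_map_sum derD).
  apply: eq_bigr => i _; rewrite (fps_mapM derD) (fps_map_derivn derD).
  by rewrite (fps_map_eq0 derD (taylor_iota iota alpha (l i))) mul0r add0r.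
split=> //; last first.
  apply: (algebraic_elt_quotient taylor0_inj domain m0 _ _ mDa);
    exact: (algebraic_elt_horner taylor0_inj).
pose yQ (Q : {poly {poly C}}) z := Q.[(y z)%:P].[z].
have extQ Q : extends (yQ Q) (map_poly taylor0 Q).[a].
  split=> [z Uz|]; last exact: expansion_horner.
  by have [b yb] := yU z Uz; eexists; apply: (expansion_horner Q yb).
exact: (extends_quotient (extQ P1) (extQ P^`()) m0 mDa LDa).
Qed.

End Solutions.

(** * Descent of the equations and of the solutions *)

Section BivariatePolynomials.
Variables (K : closedFieldType) (C : numFieldType) (iota : {rmorphism K -> C}).
Variables (m n : nat).
Local Notation I := ('I_m.+1 * 'I_n.+1)%type.

(** Polynomials in two variables as vectors of a finite-dimensional space, the
    form required by the descent. *)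
Definition bipoly (F : nzRingType) (x : I -> F) : {poly {poly F}} :=
  \poly_(k < m.+1) \poly_(i < n.+1) x (inord k, inord i).

Lemma coef_bipoly (F : nzRingType) (x : I -> F) k i :
  (bipoly x)`_k`_i = if (k < m.+1)%N && (i < n.+1)%N then x (inord k, inord i) else 0.
Proof. by rewrite coef_poly; case: ifP => _ /=; rewrite ?coef0 ?coef_poly. Qed.

Lemma bipolyP (F : nzRingType) (P Q : {poly {poly F}}) :
  (forall k i, P`_k`_i = Q`_k`_i) -> P = Q.
Proof. by move=> PQ; apply/polyP => k; apply/polyP => i. Qed.

Lemma bipoly_coef (F : nzRingType) (P : {poly {poly F}}) :
    (size P <= m.+1)%N -> (forall k, (size (P`_k)%R <= n.+1)%N) ->
  bipoly (fun u : I => P`_u.1`_u.2) = P.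
Proof.
move=> sP sPk; apply: bipolyP => k i; rewrite coef_bipoly /=.
have [lt_k|le_k] /= := ltnP k m.+1; last by rewrite (nth_default _ (leq_trans sP le_k)) coef0.
have [lt_i|le_i] /= := ltnP i n.+1; last by rewrite (nth_default _ (leq_trans (sPk k) le_i)).
by rewrite !inordK.
Qed.

Lemma bipoly_eq0 (F : nzRingType) (x : I -> F) : bipoly x = 0 -> forall u, x u = 0.
Proof.
move=> x0 [k i]; have := coef_bipoly x k i; rewrite x0 !coef0 !ltn_ord /= => ->.
by rewrite !inord_val.
Qed.

Lemma bipolyD (x y : I -> C) : bipoly (fun u => x u + y u) = bipoly x + bipoly y.
Proof. by apply: bipolyP => k i; rewrite !coefD !coef_bipoly; case: ifP; rewrite ?addr0. Qed.

Lemma bipolyZ c (x : I -> C) : bipoly (fun u => c * x u) = c%:P%:P * bipoly x.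
Proof. by apply: bipolyP => k i; rewrite !coefCM !coef_bipoly; case: ifP; rewrite ?mulr0. Qed.

Lemma bipoly_derivation D (x : I -> C) : derivation_over iota D ->
  bipoly (fun u => D (x u)) = map_poly (map_poly D) (bipoly x).
Proof.
move=> derD; apply: bipolyP => k i.
rewrite coef_map_id0 ?(map_derivation0 derD) // coef_map_id0 ?(derivation0 derD) //.
by rewrite !coef_bipoly; case: ifP; rewrite ?(derivation0 derD).
Qed.

Lemma bipoly_map (x : I -> K) :
  bipoly (fun u => iota (x u)) = map_poly (map_poly iota) (bipoly x).
Proof.
by apply: bipolyP => k i; rewrite coef_map coef_map !coef_bipoly; case: ifP => _ /=; rewrite ?rmorph0.
Qed.

End BivariatePolynomials.

(** The equations of bounded degrees for a series with coefficients in [K] form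
    a [C]-vector space stable under derivations, as the coefficients of [a] are
    constants. *)
Lemma algebraic_elt_descent (K : closedFieldType) (C : numFieldType)
    (iota : {rmorphism K -> C}) (alpha : K) (a : fps C) :
  (forall n, exists k, a n = iota k) -> algebraic_elt (taylor (iota alpha)) a ->
  exists2 Q : {poly {poly K}}, Q != 0 &
    (map_poly (taylor (iota alpha)) (map_poly (map_poly iota) Q)).[a] = 0.
Proof.
move=> aK [P P0 Pa]; pose m := size P; pose n := (\max_(k < m) size (P`_k)%R)%N.
pose ev Q := (map_poly (taylor (iota alpha)) Q).[a].
pose W := [set x : 'I_m.+1 * 'I_n.+1 -> C | ev (bipoly x) = 0].
pose x0 (u : 'I_m.+1 * 'I_n.+1) := P`_u.1`_u.2.
have Px0 : bipoly x0 = P.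
  apply: bipoly_coef => [|k]; first by rewrite leqnSn.
  have [lt_k|le_k] := ltnP k m; last by rewrite nth_default // size_poly0.
  exact: leqW (@leq_bigmax _ (fun k : 'I_m => size (P`_k)%R) (Ordinal lt_k)).
have [| | | |p [lambda [v [Wv x0E]]]] := @derivation_descent K C iota _ W _ _ _ x0.
- move=> x y; rewrite /W /= /ev bipolyD rmorphD hornerD => -> ->; exact: addr0.
- by move=> c x; rewrite /W /= /ev bipolyZ rmorphM hornerM => ->; rewrite mulr0.
- move=> D x derD; rewrite /W /= /ev (bipoly_derivation _ derD) => xa.
  have := fps_map_horner derD alpha (bipoly x) a.
  by rewrite xa (fps_map0 derD) (fps_map_eq0 derD aK) mulr0 addr0 => <-.
- by rewrite /W /= Px0.
have [j vj] : exists j, bipoly (v j) != 0.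
  apply: contrapT => /forallNP v0; move/eqP: P0; apply; rewrite -Px0.
  apply: bipolyP => k i; rewrite coef_bipoly !coef0; case: ifP => // _.
  rewrite x0E big1 // => j _.
  have /negP := v0 j; rewrite negbK => /eqP/bipoly_eq0 ->; by rewrite rmorph0 mulr0.
by exists (bipoly (v j)) => //; rewrite -bipoly_map; apply: Wv.
Qed.

(** The descent applies to the initial values [(b 0, ..., b (r - 1))], which
    determine the solution [b]. *)
Lemma algebraic_solution_descent (R : realType) (iota : {rmorphism algC -> R[i]})
    (U : set R[i]) (r : nat) (l : nat -> {poly algC}) (alpha : algC) :
    open U -> pathwise_connected U ->
    U (iota alpha) -> (forall z, U z -> (map_poly iota (l r)).[z] != 0) ->
  forall a, algebraic_solution iota U r l alpha a ->
  exists (p : nat) (lambda : 'I_p -> R[i]) (b : 'I_p -> fps R[i]),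
    [/\ forall i, algebraic_solution iota U r l alpha (b i),
        forall i n, exists k, b i n = iota k
      & a = \sum_(i < p) fps_of_poly (lambda i)%:P * b i].
Proof.
move=> oU pathU Ualpha lr a sol_a.
pose W := [set u : 'I_r -> R[i] | exists2 b, algebraic_solution iota U r l alpha b &
  forall i, u i = b i].
have lr0 : taylor (iota alpha) (map_poly iota (l r)) 0%N != 0 by rewrite coef0_taylor lr.
have inj_op b : local_op iota r l (iota alpha) b = 0 -> (forall i : 'I_r, b i = 0) -> b = 0.
  move=> Lb b0; apply: (fps_op_inj lr0 Lb) => i lt_ir.
  exact: (b0 (Ordinal lt_ir)).
have cM c (b : fps R[i]) n : (fps_of_poly c%:P * b) n = c * b n.
  rewrite fpsM big_ord_recl big1 ?addr0 => [|i _]; last first.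
    by rewrite /fps_of_poly coefC mul0r.
  by rewrite /fps_of_poly coefC subn0.
have [| | | |p [lambda [v [Wv aE]]]] := @derivation_descent algC R[i] iota _ W _ _ _ (fun i => a i).
- move=> u u' [b sb ub] [b' sb' ub']; exists (b + b') => [|i]; last by rewrite ub ub'.
  exact: algebraic_solutionD.
- move=> c u [b sb ub]; exists (fps_of_poly c%:P * b) => [|i]; last by rewrite cM ub.
  exact: algebraic_solutionM.
- move=> D u derD [b sb ub]; exists (fps_map D b) => [|i]; last by rewrite ub.
  exact: algebraic_solution_derivation.
- by exists a.
have /choice[b bP] i : exists b, algebraic_solution iota U r l alpha b /\
    forall k : 'I_r, iota (v i k) = b k by have [b sb vb] := Wv i; exists b.
exists p, lambda, b; split=> [i|i|].
- by have [] := bP i.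
- move=> n; have [sb vb] := bP i; apply: derivation_constant => D derD.
  have [_ Lb _] := algebraic_solution_derivation oU pathU Ualpha lr derD sb.
  have -> // : D (b i n) = fps_map D (b i) n by [].
  by rewrite (inj_op _ Lb) // => k; rewrite /fps_map -vb (derivationK derD).
apply/eqP; rewrite -subr_eq0; apply/eqP.
have Lsum : local_op iota r l (iota alpha) (\sum_(i < p) fps_of_poly (lambda i)%:P * b i) = 0.
  apply: (big_rec (fun c => local_op iota r l (iota alpha) c = 0)).
    exact: local_op0.
  by move=> i c _ Lc; rewrite local_opD local_opM Lc; have [[_ -> _] _] := bP i; rewrite mulr0 addr0.
have La : local_op iota r l (iota alpha) a = 0 by case: sol_a.
apply: inj_op => [|k].
  rewrite local_opD La add0r -mulN1r -(rmorphN1 (@fps_of_poly R[i])) -polyCN.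
  by rewrite local_opM Lsum mulr0.
rewrite fpsD fpsN fps_sum aE; apply/eqP; rewrite subr_eq0; apply/eqP.
by apply: eq_bigr => i _; rewrite cM; have [_ ->] := bP i.
Qed.

Theorem proposition7 (R : realType) (iota : {rmorphism algC -> R[i]})
    (L : diffop algC) (Omega : set R[i]) (f : R[i] -> R[i]) :
  L != 0 ->
  cut_plane Omega ->
  (forall z, Omega z -> ~ singularity iota L z) ->
  analytic_on Omega f ->
  algebraic_on (idfun : {rmorphism R[i] -> R[i]}) Omega f ->
  solution_on iota Omega L f ->
  exists (p : nat) (lambda : 'I_p -> R[i]) (g : 'I_p -> R[i] -> R[i]),
    (forall i, [/\ analytic_on Omega (g i),
                   algebraic_on iota Omega (g i)
                 & solution_on iota Omega L (g i)]) /\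
    (forall z, Omega z -> f z = \sum_(i < p) lambda i * g i z).
Proof.
move=> L0 [oU [U0 pathU _]] regL /[dup] f_an /analytic_onP fU f_alg f_sol.
have [alpha Ualpha] := rmorph_algC_dense iota oU U0.
have [r [l [lr solP]]] := solution_onP L0 oU regL.
have ident := identity_theorem pathU.
have [a fa] := fU _ Ualpha.
have sol_a : algebraic_solution iota Omega r l alpha a.
  split; first by exists f.
    have Lf := expansion_op (fun i => map_poly iota (l i)) r fa.
    apply: (@expansion_eq0 _ (iota alpha)); apply: expansion_near Lf.
    have := open_nbhs_nbhs (conj oU Ualpha); apply: filterS => z Uz.
    by have /(solP f f_an) := f_sol; apply.
  have [P P0 Pf] := (algebraic_onP _ _ _).1 f_alg; exists P => //.
  apply: (@expansion_eq0 _ (iota alpha)); apply: expansion_near (expansion_horner P fa).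
  have := open_nbhs_nbhs (conj oU Ualpha); apply: filterS => z Uz.
  have := Pf z Uz; congr (_.[_].[_] = _).
  by rewrite map_poly_id // => p _; rewrite map_poly_id.
have [p [lambda [b [sol_b bK aE]]]] := algebraic_solution_descent oU pathU Ualpha lr sol_a.
have /choice[g gP] i : exists y, extends iota Omega alpha y (b i) by case: (sol_b i).
exists p, lambda, g; split=> [i|z Uz].
  have [gU gb] := gP i; have g_an : analytic_on Omega (g i) by apply/analytic_onP.
  have [_ Lb alg_b] := sol_b i; split=> //.
    have [Q Q0 Qb] := algebraic_elt_descent (bK i) alg_b.
    apply/algebraic_onP; exists Q => // z Uz.
    have := expansion_horner (map_poly (map_poly iota) Q) gb; rewrite Qb => Q_0.
    apply: (expansion_value (ident _ _ _ Ualpha Q_0 z Uz)) => w Uw.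
    by have [c gc] := gU w Uw; eexists; apply: (expansion_horner _ gc).
  apply/(solP _ g_an) => z Uz.
  have := expansion_op (fun i => map_poly iota (l i)) r gb.
  rewrite -/(local_op _ _ _ _ _) Lb => L_0.
  apply: (expansion_value (ident _ _ _ Ualpha L_0 z Uz)) => w Uw.
  by have [c gc] := gU w Uw; eexists; apply: (expansion_op (fun i => map_poly iota (l i)) r gc).
have sum_exp w (c : 'I_p -> fps R[i]) : (forall i, expansion w (g i) (c i)) ->
    expansion w (fun z => \sum_(i < p) lambda i * g i z) (\sum_(i < p) fps_of_poly (lambda i)%:P * c i).
  by move=> gc; apply: (@expansion_sum _ _ p (fun i z => lambda i * g i z)
    (fun i => fps_of_poly (lambda i)%:P * c i)) => i; apply: expansionM (expansionC _ _) (gc i).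
have diff_0 := expansionD fa (expansionN (sum_exp _ _ (fun i => (gP i).2))).
rewrite -aE subrr in diff_0.
apply/eqP; rewrite -subr_eq0; apply/eqP.
apply: (expansion_value (ident _ _ _ Ualpha diff_0 z Uz)) => w Uw.
have [c fc] := fU w Uw.
have /choice[d gd] i : exists d, expansion w (g i) d by have [gU _] := gP i; apply: gU.
by eexists; apply: (expansionD fc (expansionN (sum_exp w d gd))).
Qed.
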